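(* Let $\Delta\ge4$. There is a deterministic (shift-based) algorithm that maintains a proper $(2\Delta-2)$-edge coloring of a fully dynamic $n$-vertex graph with maximum degree at most $\Delta$, with worst-case recourse $O(\frac{\log n}{\log\Delta})$ per insertion, where determining the recoloring takes $O(m)$ time ($m$ the current number of edges). This recourse is tight, matching up to a constant factor the worst-case lower bound $\Omega(\frac{\log n}{\log\Delta})$ for $(2\Delta-2)$-edge coloring (there are $n$-vertex graphs of maximum degree at most $\Delta$, properly $(2\Delta-2)$-edge colored except one edge, for which every extension recolors that many edges).
   Context: Dynamic model: $n$ fixed vertices, a simple graph under edge insertions and deletions, maximum degree always at most $\Delta$; a proper edge coloring (adjacent edges get distinct colors) with $2\Delta-2$ colors is maintained. Recourse = number of previously colored edges whose color changes while processing an update. *)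

(* Defs.v *)
From mathcomp Require Import all_boot.

Set Implicit Arguments.
Unset Strict Implicit.
Unset Printing Implicit Defensive.

(** * Graphs and partial edge colorings

    The vertex set is ['I_n]; a graph is its set of edges, an edge being a
    two-element set of vertices.  A partial edge coloring maps every vertex set
    to [None] (uncolored) or to one of [q] colors. *)

Definition graph n := {set {set 'I_n}}.
Definition pcoloring n q := {ffun {set 'I_n} -> option 'I_q}.

Definition simple n (G : graph n) := forall e, e \in G -> #|e| = 2.

Definition degree n (G : graph n) (v : 'I_n) := #|[set e in G | v \in e]|.

Definition maxdeg_le n (D : nat) (G : graph n) := forall v, degree G v <= D.

Definition adjacent n (e f : {set 'I_n}) := (e != f) && (e :&: f != set0).

Definition proper_partial n q (G : graph n) (phi : pcoloring n q) :=
  (forall e, e \notin G -> phi e = None) /\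
  (forall e f, e \in G -> f \in G -> adjacent e f ->
     phi e <> None -> phi e <> phi f).

Definition proper_coloring n q (G : graph n) (phi : pcoloring n q) :=
  proper_partial G phi /\ (forall e, e \in G -> phi e <> None).

(** [phi] is the coloring before and [psi] the coloring after the update; [G]
    is the graph after it, so that a deleted edge is not counted, and neither
    is an inserted one, since [phi] leaves it uncolored. *)
Definition recourse n q (G : graph n) (phi psi : pcoloring n q) : nat :=
  #|[set e in G | (phi e != None) && (psi e != phi e)]|.

(** * Shifts

    Shifting from the uncolored edge [e] to the adjacent colored edge [f] moves
    the color of [f] to [e] and leaves [f] uncolored.  A sequence [s] of edges
    is shiftable from [e] when these moves can be performed one after the other
    while the partial coloring stays proper. *)

Definition shift1 n q (phi : pcoloring n q) (e f : {set 'I_n}) :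
    pcoloring n q :=
  [ffun g => if g == e then phi f else if g == f then None else phi g].

Fixpoint shift n q (phi : pcoloring n q) (e : {set 'I_n})
    (s : seq {set 'I_n}) : pcoloring n q :=
  if s is f :: s' then shift (shift1 phi e f) f s' else phi.

Fixpoint shiftable n q (G : graph n) (phi : pcoloring n q) (e : {set 'I_n})
    (s : seq {set 'I_n}) : Prop :=
  phi e = None /\
  if s is f :: s' then
    [/\ adjacent e f, phi f <> None, proper_partial G (shift1 phi e f)
      & shiftable G (shift1 phi e f) f s']
  else True.

Definition set_color n q (phi : pcoloring n q) (e : {set 'I_n}) (c : 'I_q) :
    pcoloring n q :=
  [ffun g => if g == e then Some c else phi g].

(** The uncolored edge is shifted from [e] along some sequence of edges, and the
    edge left uncolored at the end receives a color. *)
Definition shift_extension n q (G : graph n) (e : {set 'I_n})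
    (phi psi : pcoloring n q) :=
  exists s c, shiftable G phi e s /\
    psi = set_color (shift phi e s) (last e s) c.

(** * A word RAM

    Programs of a while language over finitely many arrays of words, with unit
    cost for every elementary operation.  Words are the naturals below [W]:
    evaluation is stuck as soon as a value reaches [W].  Scalars are cells of
    arrays; subtraction is truncated; comparisons return 0 or 1. *)

Definition memory := nat -> nat -> nat.

Definition upd (s : memory) (a i x : nat) : memory :=
  fun b j => if (b == a) && (j == i) then x else s b j.

Variant binop := Add | Sub | Mul | Lt | Eq.

Inductive expr :=
| Lit of nat
| Get of nat & expr
| Bin of binop & expr & expr.

Inductive cmd :=
| Skip
| Put of nat & expr & expr
| Seq of cmd & cmd
| If of expr & cmd & cmd
| While of expr & cmd.

Definition binop_val (o : binop) (x y : nat) : nat :=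
  match o with
  | Add => x + y
  | Sub => x - y
  | Mul => x * y
  | Lt => x < y
  | Eq => x == y
  end.

Definition word (W x : nat) : option nat := if x < W then Some x else None.

Fixpoint eval (W : nat) (s : memory) (e : expr) : option nat :=
  match e with
  | Lit k => word W k
  | Get a i => if eval W s i is Some j then Some (s a j) else None
  | Bin o e1 e2 =>
      if eval W s e1 is Some x then
        if eval W s e2 is Some y then word W (binop_val o x y) else None
      else None
  end.

Fixpoint cost (e : expr) : nat :=
  match e with
  | Lit _ => 1
  | Get _ i => (cost i).+1
  | Bin _ e1 e2 => (cost e1 + cost e2).+1
  end.

(** [exec W p s t s']: started in memory [s], program [p] halts in memory [s']
    after [t] elementary steps. *)
Inductive exec (W : nat) : cmd -> memory -> nat -> memory -> Prop :=
| ExecSkip s : exec W Skip s 1 s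
| ExecPut a i e s j x :
    eval W s i = Some j -> eval W s e = Some x ->
    exec W (Put a i e) s (cost i + cost e).+1 (upd s a j x)
| ExecSeq p1 p2 s s1 s2 t1 t2 :
    exec W p1 s t1 s1 -> exec W p2 s1 t2 s2 ->
    exec W (Seq p1 p2) s (t1 + t2) s2
| ExecIf b p1 p2 s s' x t :
    eval W s b = Some x -> exec W (if x != 0 then p1 else p2) s t s' ->
    exec W (If b p1 p2) s (cost b + t).+1 s'
| ExecWhileEnd b p s :
    eval W s b = Some 0 -> exec W (While b p) s (cost b).+1 s
| ExecWhile b p s s1 s2 x t1 t2 :
    eval W s b = Some x -> x != 0 ->
    exec W p s t1 s1 -> exec W (While b p) s1 t2 s2 ->
    exec W (While b p) s (cost b + t1 + t2).+1 s2.

Lemma exec_det W p s t1 s1 t2 s2 :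
  exec W p s t1 s1 -> exec W p s t2 s2 -> t1 = t2 /\ s1 = s2.
Proof.
move=> H; elim: H t2 s2 => {p s t1 s1}.
- by move=> s t2 s2 H; inversion H.
- move=> a i e s j x Hi He t2 s2 H.
  inversion H as [|? ? ? ? j' x' Hj Hx| | | |]; subst.
  by move: Hj Hx; rewrite Hi He => -[<-] [<-].
- move=> p1 p2 s s1 s2 t1 t2 _ IH1 _ IH2 t s' H.
  inversion H as [| |? ? ? ? ? ? ? H1 H2| | |]; subst.
  by case: (IH1 _ _ H1) => ? ?; subst; case: (IH2 _ _ H2) => -> ->.
- move=> b p1 p2 s s' x t Hb _ IH t2 s2 H.
  inversion H as [| | |? ? ? ? ? ? ? Hx H1| |]; subst.
  by move: Hx H1; rewrite Hb => -[<-] /IH [-> ->].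
- move=> b p s Hb t2 s2 H.
  inversion H as [| | | |? ? ? Hx|? ? ? ? ? ? ? ? Hx Hn]; subst => //.
  by move: Hx Hn; rewrite Hb => -[<-].
- move=> b p s s1 s2 x t1 t2 Hb Hx _ IH1 _ IH2 t s' H.
  inversion H as [| | | |? ? ? H0|? ? ? ? ? ? ? ? H0 Hn H1 H2]; subst.
    by move: H0 Hx; rewrite Hb => -[->].
  by case: (IH1 _ _ H1) => ? ?; subst; case: (IH2 _ _ H2) => -> ->.
Qed.

(** * Dynamic edge coloring

    [n] fixed vertices, initially no edge, and an all-zero memory that persists
    between updates.  Array 0 is the input: its cells 0 to 3 hold [n], the
    degree bound and the two endpoints of the edge of the current update.
    Array 1 is the output: its cell [u * n + v] holds the color of the edge
    [uv], the [c]-th color being written [c.+1]. *)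

Variant update n := Insert of 'I_n & 'I_n | Delete of 'I_n & 'I_n.

Definition edge n (up : update n) : {set 'I_n} :=
  match up with Insert u v | Delete u v => [set u; v] end.

Definition apply_update n (G : graph n) (up : update n) : graph n :=
  match up with
  | Insert _ _ => edge up |: G
  | Delete _ _ => G :\ edge up
  end.

Definition valid_update n (D : nat) (G : graph n) (up : update n) : Prop :=
  match up with
  | Insert u v =>
      [/\ u != v, edge up \notin G & maxdeg_le D (apply_update G up)]
  | Delete _ _ => edge up \in G
  end.

Definition memory0 : memory := fun _ _ => 0.

Definition load n (D : nat) (up : update n) (s : memory) : memory :=
  let: (u, v) := match up with Insert u v | Delete u v => (u, v) end in
  upd (upd (upd (upd s 0 0 n) 0 1 D) 0 2 u) 0 3 v.

Definition color_code q (c : option 'I_q) : nat :=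
  if c is Some i then i.+1 else 0.

Definition stores n q (s : memory) (G : graph n) (phi : pcoloring n q) :=
  (forall u v : 'I_n, [set u; v] \in G ->
     s 1 (u * n + v) = color_code (phi [set u; v])) /\
  (forall e, e \notin G -> phi e = None).

Definition program_for n (ins del : cmd) (up : update n) : cmd :=
  match up with Insert _ _ => ins | Delete _ _ => del end.

(** The configurations (graph, stored coloring, memory) that arise from valid
    update sequences when [ins] processes insertions and [del] deletions. *)
Inductive reachable (W : nat) (ins del : cmd) (D n q : nat) :
    graph n -> pcoloring n q -> memory -> Prop :=
| ReachInit : reachable W ins del D set0 [ffun=> None] memory0
| ReachStep G phi s up t s' phi' :
    reachable W ins del D G phi s ->
    valid_update D G up ->
    exec W (program_for ins del up) (load D up s) t s' ->
    stores s' (apply_update G up) phi' ->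
    reachable W ins del D (apply_update G up) phi' s'.

(* Main.v *)
Require Import Defs.
From mathcomp Require Import all_boot all_order all_algebra.
From mathcomp Require Import reals exp.
From mathcomp Require Import zify.

Set Implicit Arguments.
Unset Strict Implicit.
Unset Printing Implicit Defensive.

(** Upper bound. If the uncolored edge [uv] has no free color, then [u] and
    [v] see complementary classes of [D - 1] colors each. Search from [u]:
    at a vertex of type [t] expand all the edges whose color is in class
    [t], and give their other ends the opposite type. A vertex that sees its
    whole class sees exactly one color outside of it, namely that of the
    edge through which it was reached; hence the expanded vertices are
    pairwise distinct, the search tree branches [D - 1] times everywhere,
    and a vertex [x] that misses a color of its class is met at depth [O(log
    n / log D)]. All the shifts along the branch to [x] are legal.
    Afterwards the parent of [x] sees only colors outside the class of [x];
    and if [x] itself lies on the branch, with the opposite type, it sees at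
    most one color of that class, so that the last edge has a free color.
    Every expanded vertex has degree [D], so that the search takes linear
    time, given a table of the neighbor of each vertex in each color.

    Lower bound. In a tree whose vertices see one class below and one edge
    of the other class above, with the two classes exchanged at each level,
    giving the edge above a vertex a color of the class below forces some
    edge below to leave that class, and so on down to the leaves. *)

(* [lia] compares cardinals syntactically, [set] up to conversion. *)
Ltac card_lia :=
  repeat match goal with H : context [@card.body _ _] |- _ => revert H end;
  repeat match goal with |- context [@card.body ?T ?A] =>
    let k := fresh "k" in set k := (@card.body T A); clearbody k end;
  intros; lia.

(* Equalities of booleans make [lia] exponentially slow. *)
Ltac nat_lia :=
  repeat match goal with H : @eq bool _ _ |- _ => clear H end; lia.

(** * Colors seen at a vertex *)

(** The delicate point of the upper bound is that shifting changes colors which the search has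
    already used. The tree therefore always refers to the original coloring, and [moving] retains of
    the shifted one only what the later steps use: edges away from the visited vertices are as
    before, and a vertex with a class sees at most one color outside it. The vertex [v] is treated
    as an internal vertex of type [false]. Depth is never defined: by [tree_edge] the index of a
    parent is smaller by a factor [D - 1], and following parents up to the root yields the
    logarithm. Linear time needs care because [D] may exceed the number of edges: a scan for a free
    color is paid for by the colors seen, and a search starts only when [u] sees [D - 1] colors, so
    that [D - 1 <= #|G|]. A nonempty shift also forces [D <= n], hence [ln n / ln D >= 1], which
    absorbs the rounding. In the lower bound the tree is numbered like a heap, so that the edges
    forced to change have increasing, hence distinct, indices. *)

Definition sees n q (psi : pcoloring n q) (v : 'I_n) (c : 'I_q) :=
  [exists w, psi [set v; w] == Some c].

(** Properness with no mention of the graph: each color class is a matching. This is also the form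
    that the neighbor table yields directly. *)
Definition matching n q (psi : pcoloring n q) :=
  forall v w w' c, psi [set v; w] = Some c -> psi [set v; w'] = Some c ->
    w = w'.

Definition uncolor n q (psi : pcoloring n q) (e : {set 'I_n}) : pcoloring n q :=
  [ffun g => if g == e then None else psi g].

Lemma card_below (q m : nat) : m <= q -> #|[set c : 'I_q | c < m]| = m.
Proof.
move=> mq; have inj : injective (widen_ord mq).
  by move=> x y /(congr1 val) /= /val_inj.
rewrite -[RHS]card_ord -(card_imset _ inj).
apply: eq_card => c; rewrite !inE; apply/idP/imsetP => [cm|[x _ ->]].
  by exists (Ordinal cm) => //; apply: val_inj.
by rewrite /= ltn_ord.
Qed.

Lemma set2_inj (T : finType) (v w w' : T) : [set v; w] = [set v; w'] -> w = w'.
Proof.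
move=> E; have: w \in [set v; w'] by rewrite -E !inE eqxx orbT.
have: w' \in [set v; w] by rewrite E !inE eqxx orbT.
by rewrite !inE => /orP[/eqP->|/eqP->] // /orP[/eqP->|/eqP->].
Qed.

Lemma seesP n q (psi : pcoloring n q) v c :
  reflect (exists w, psi [set v; w] = Some c) (sees psi v c).
Proof.
by apply: (iffP existsP) => -[w]; [move/eqP; exists w | move/eqP; exists w].
Qed.

Lemma sees_edge n q (psi : pcoloring n q) v w c :
  psi [set v; w] = Some c -> sees psi v c /\ sees psi w c.
Proof.
by move=> H; split; apply/seesP; [exists w | exists v; rewrite setUC].
Qed.

Lemma simple_pair n (G : graph n) e v : simple G -> e \in G -> v \in e ->
  exists2 w, e = [set v; w] & v != w.
Proof.
move=> sG eG ve; have /eqP := sG e eG; rewrite (cardsD1 v) ve eqSS.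
move=> /cards1P[w Ew]; exists w; first by rewrite -Ew setD1K.
by have /setD1P[] : w \in e :\ v; rewrite ?Ew ?inE // eq_sym.
Qed.

Lemma simple_neq n (G : graph n) v w : simple G -> [set v; w] \in G -> v != w.
Proof. by move=> sG /sG; rewrite cards2; case: eqP. Qed.

Lemma card_sees n q (G : graph n) (psi : pcoloring n q) v :
  (forall f, psi f <> None -> f \in G) ->
  #|[set c | sees psi v c]| <= degree G v.
Proof.
move=> supp; rewrite /degree.
have inj : injective (@Some 'I_q) by move=> x y [].
rewrite -(card_imset _ inj).
apply: leq_trans (leq_imset_card psi _); apply/subset_leq_card/subsetP => o.
move=> /imsetP[c]; rewrite inE => /seesP[w E] ->.
apply/imsetP; exists [set v; w]; rewrite // !inE eqxx supp ?E //.
Qed.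

Lemma handshake n (G : graph n) : simple G -> \sum_v degree G v = 2 * #|G|.
Proof.
move=> sG; transitivity (\sum_(e in G) \sum_v (v \in e)).
  rewrite exchange_big; apply: eq_bigr => v _.
  rewrite /degree -sum1dep_card big_mkcondr /=.
  by apply: eq_bigr => e eG; case: (v \in e).
rewrite mulnC -sum_nat_const; apply: eq_bigr => e /sG <-.
by rewrite -sum1_card [RHS]big_mkcond.
Qed.

Lemma degree_le n (G : graph n) v : degree G v <= #|G|.
Proof. by apply/subset_leq_card/subsetP => e; rewrite inE => /andP[]. Qed.

(** * Matchings under uncoloring, coloring and shifting *)

Lemma matching_proper n q (G : graph n) (psi : pcoloring n q) :
  simple G -> (forall f, f \notin G -> psi f = None) -> matching psi ->
  proper_partial G psi.
Proof.
move=> sG supp mpsi; split=> // e f eG fG /andP[nef /set0Pn[v]].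
rewrite inE => /andP[ve vf].
case: (simple_pair sG eG ve) nef => w -> _;
  case: (simple_pair sG fG vf) => w' -> _.
move=> nef; case E: (psi _) => [c|] // _ /esym E'.
by rewrite (mpsi _ _ _ _ E E') eqxx in nef.
Qed.

(** The program performs a shift as these two operations, in this order. *)
Lemma shift1E n q (psi : pcoloring n q) e f c : psi f = Some c ->
  shift1 psi e f = set_color (uncolor psi f) e c.
Proof. by move=> E; apply/ffunP => g; rewrite !ffunE E. Qed.

Lemma matching_uncolor n q (psi : pcoloring n q) f :
  matching psi -> matching (uncolor psi f).
Proof.
move=> m v w w' c; rewrite !ffunE; case: eqP => // _; case: eqP => // _.
exact: m.
Qed.

Lemma set2_eqP (T : finType) (v w a b : T) :
  [set v; w] = [set a; b] -> (v = a /\ w = b) \/ (v = b /\ w = a).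
Proof.
move=> E; have: v \in [set a; b] by rewrite -E !inE eqxx.
rewrite !inE => /orP[]/eqP va; subst v; [left|right]; split=> //.
  exact: set2_inj E.
by apply: (@set2_inj _ b); rewrite E setUC.
Qed.

Lemma matching_set_color n q (psi : pcoloring n q) a b c :
  matching psi -> ~~ sees psi a c -> ~~ sees psi b c ->
  matching (set_color psi [set a; b] c).
Proof.
move=> m na nb v w w' d; rewrite !ffunE.
have H x y : [set v; x] = [set a; b] -> psi [set v; y] <> Some c.
  move=> /set2_eqP[[-> _]|[-> _]] E; [move/negP: na|move/negP: nb];
  by apply; apply/seesP; exists y.
case: eqP => [E|_]; case: eqP => [E'|_].
- by rewrite -E' in E; move=> _ _; apply: set2_inj E.
- by move=> [<-] /(H _ _ E).
- by move=> H1 [H2]; case: (H _ w E'); rewrite H1 H2.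
- exact: m.
Qed.

Lemma sees_uncolor n q (psi : pcoloring n q) f v c :
  sees (uncolor psi f) v c -> sees psi v c.
Proof.
by move=> /seesP[w]; rewrite ffunE; case: eqP => // _ E; apply/seesP; exists w.
Qed.

Lemma uncolor_unseen n q (psi : pcoloring n q) v w c :
  matching psi -> psi [set v; w] = Some c ->
    ~~ sees (uncolor psi [set v; w]) v c.
Proof.
move=> m E; apply/negP => /seesP[w']; rewrite ffunE; case: eqP => // ne E'.
by apply: ne; rewrite (m _ _ _ _ E E').
Qed.

Lemma sees_set_color n q (psi : pcoloring n q) a b v c d :
  sees (set_color psi [set a; b] c) v d ->
  sees psi v d \/ (d = c /\ v \in [set a; b]).
Proof.
move=> /seesP[w]; rewrite ffunE; case: eqP => [<-|_ E]; last first.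
  by left; apply/seesP; exists w.
by case=> ->; right; rewrite !inE eqxx.
Qed.

(** [shiftable] recurses from the front, whereas the program adds its shifts one at a time at the
    end. *)
Lemma shiftable_rcons n q (G : graph n) (phi : pcoloring n q) e s f :
  shiftable G phi e s -> adjacent (last e s) f ->
  shift phi e s f <> None ->
  proper_partial G (shift1 (shift phi e s) (last e s) f) ->
  shiftable G phi e (rcons s f).
Proof.
elim: s phi e => [|g s IH] phi e /=.
  move=> [pe _] adj pf pp; do 2!split=> //.
  by rewrite ffunE eqxx eq_sym; case/andP: adj => /negbTE->.
by move=> [pe [a1 a2 a3 a4]] adj pf pp; do 2!split=> //; apply: IH.
Qed.

Lemma shift_rcons n q (phi : pcoloring n q) e s f :
  shift phi e (rcons s f) = shift1 (shift phi e s) (last e s) f.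
Proof. by elim: s phi e => //= g s IH phi e. Qed.

Lemma shift_unchanged n q (phi : pcoloring n q) e s g :
  g \notin e :: s -> shift phi e s g = phi g.
Proof.
elim: s phi e => //= f s IH phi e; rewrite !inE !negb_or => /and3P[ne nf ns].
by rewrite IH ?inE ?negb_or ?nf // ffunE (negbTE ne) (negbTE nf).
Qed.

(** Only edges of [e :: s] can change, and [e] was uncolored, so that it does not count. *)
Lemma recourse_shift n q (G : graph n) (phi psi : pcoloring n q) e s c :
  phi e = None -> psi = set_color (shift phi e s) (last e s) c ->
  recourse G phi psi <= size s.
Proof.
move=> pe ->; apply: leq_trans (card_size s);
  apply/subset_leq_card/subsetP => g.
rewrite !inE => /and3P[_ pg]; apply: contraNT => gs; rewrite ffunE.
have ge : g != e by apply: contraNneq pg => ->; rewrite pe.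
case: (g =P _) => [E|_]; last by rewrite shift_unchanged ?inE ?negb_or ?ge.
have := mem_last e s; rewrite -E inE (negbTE ge) /= => gs'.
by rewrite gs' in gs.
Qed.

(** * The search tree of a blocked edge *)

Record node n q := Node {vtx : 'I_n; typ : bool; par : nat; via : 'I_q}.

Section Blocked.

Variables (n D : nat) (G : graph n) (phi : pcoloring n (2 * D - 2))
  (u v : 'I_n).

(* The class of type [t] consists of the colors [c] with [sees phi u c = t]. *)
Definition full y t := forall c, sees phi u c = t -> sees phi y c.

(* The queue of a search from [u], whose first [i] vertices have been expanded.
   The bound on [par] says that each expansion adds [D - 1] vertices. *)
Record tree (d : node n (2 * D - 2)) (s : seq (node n (2 * D - 2))) (i : nat) :
    Prop := Tree {
  tree_size : i < size s;
  tree_root : vtx (nth d s 0) = u /\ typ (nth d s 0) = true;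
  tree_edge : forall j, 0 < j < size s ->
    let x := nth d s j in let y := nth d s (par x) in
    [/\ par x * (D - 1) < j, phi [set vtx y; vtx x] = Some (via x),
        sees phi u (via x) = typ y & typ x = ~~ typ y];
  tree_inj : forall j j', 0 < j < size s -> 0 < j' < size s ->
    par (nth d s j) = par (nth d s j') -> via (nth d s j) = via (nth d s j') ->
    j = j';
  tree_full : forall j, j < i -> full (vtx (nth d s j)) (typ (nth d s j)) }.

Record blocked_edge : Prop := BlockedEdge {
  be_deg : 4 <= D;
  be_simple : simple G;
  be_neq : u != v;
  be_notin : [set u; v] \notin G;
  be_maxdeg : maxdeg_le D ([set u; v] |: G);
  be_supp : forall f, (phi f == None) = (f \notin G);
  be_match : matching phi;
  be_blocked : forall c, sees phi u c || sees phi v c }.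

Hypothesis B : blocked_edge.

Let D_ge := be_deg B.
Let sG := be_simple B.
Let uv := be_neq B.
Let eG := be_notin B.
Let degG := be_maxdeg B.
Let suppphi := be_supp B.
Let mphi := be_match B.
Let blocked := be_blocked B.

Let G' := [set u; v] |: G.

Lemma simple_insert : simple G'.
Proof. by move=> f /setU1P[->|/sG //]; rewrite cards2 uv. Qed.

Lemma degree_insert y : degree G y + (y \in [set u; v]) <= D.
Proof.
apply: leq_trans (degG y); rewrite /degree.
case: (boolP (y \in _)) => ye; last first.
  by rewrite addn0; apply/subset_leq_card/subsetP => f;
    rewrite !inE => /andP[-> ->]; rewrite orbT.
rewrite addn1; apply: (@leq_trans #|[set u; v] |: [set e in G | y \in e]|).
  by rewrite cardsU1 inE (negbTE eG).
apply/subset_leq_card/subsetP => f /setU1P[->|].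
  by rewrite in_set ye setU11.
by rewrite !in_set => /andP[-> ->]; rewrite orbT.
Qed.

Lemma sees_degree y : #|[set c | sees phi y c]| + (y \in [set u; v]) <= D.
Proof.
apply: leq_trans (degree_insert y); rewrite leq_add2r; apply: card_sees => f.
by move/eqP; rewrite suppphi negbK.
Qed.

(** Before the insertion both ends have degree at most [D - 1]. Two sets of at most [D - 1] colors
    that cover all [2 * D - 2] colors are disjoint. *)
Lemma class_compl c : sees phi v c = ~~ sees phi u c.
Proof.
have hu := sees_degree u; have hv := sees_degree v.
rewrite !inE eqxx /= addn1 in hu; rewrite !inE eqxx orbT addn1 in hv.
have cU : #|[set c | sees phi u c] :|: [set c | sees phi v c]| = 2 * D - 2.
  rewrite -[RHS](card_ord (2 * D - 2)) -cardsT; apply: eq_card => x.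
  by rewrite !inE blocked.
have := cardsUI [set c | sees phi u c] [set c | sees phi v c]; rewrite cU => cI.
have /eqP : #|[set c | sees phi u c] :&: [set c | sees phi v c]| = 0
  by card_lia.
rewrite cards_eq0 => /eqP /setP /(_ c); rewrite !inE.
by have := blocked c; case: (sees phi u c); case: (sees phi v c).
Qed.

Lemma card_class t : #|[set c | sees phi u c == t]| = D - 1.
Proof.
have hu := sees_degree u; have hv := sees_degree v.
rewrite !inE eqxx /= addn1 in hu; rewrite !inE eqxx orbT addn1 in hv.
have := cardsC [set c | sees phi u c]; rewrite card_ord.
have -> : ~: [set c | sees phi u c] = [set c | sees phi v c].
  by apply/setP => c; rewrite !inE class_compl.
move=> hc; case: t.
  suff -> : [set c | sees phi u c == true] = [set c | sees phi u c] by card_lia.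
  by apply/setP => c; rewrite !inE; case: sees.
suff -> : [set c | sees phi u c == false] = [set c | sees phi v c] by card_lia.
by apply/setP => c; rewrite !inE class_compl; case: sees.
Qed.

Lemma full_v : full v false. Proof. by move=> c; rewrite class_compl => ->. Qed.

(** With a second color outside its class, [y] would see at least [D + 1] colors. *)
Lemma full_off y t c c' : full y t -> sees phi y c -> sees phi y c' ->
  sees phi u c = ~~ t -> sees phi u c' = ~~ t -> c = c'.
Proof.
move=> fy yc yc' uc uc'; apply/eqP; apply: contraT => ne.
have := sees_degree y; suff : D < #|[set c | sees phi y c]| by card_lia.
apply: (@leq_trans #|[set c; c'] :|: [set c | sees phi u c == t]|).
  rewrite cardsU cards2 ne card_class.
  suff -> : #|[set c; c'] :&: [set c0 | sees phi u c0 == t]| = 0 by card_lia.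
  apply/eqP; rewrite cards_eq0; apply/eqP/setP => x; rewrite !inE.
  apply/negP => /andP[/orP[]/eqP->]; rewrite ?uc ?uc'; by case: (t).
apply/subset_leq_card/subsetP => x; rewrite !inE.
by case/orP => [/orP[]/eqP->|/eqP/fy].
Qed.

(** A vertex full for both types would see all [2 * D - 2 > D] colors. *)
Lemma full_typ y t t' : full y t -> full y t' -> t = t'.
Proof.
move=> ft ft'; apply/eqP; apply: contraT => ne.
have := sees_degree y;
  suff -> : #|[set c | sees phi y c]| = 2 * D - 2 by card_lia.
rewrite -[RHS](card_ord (2 * D - 2)) -cardsT; apply: eq_card => c.
rewrite !inE; case: (sees phi u c =P t) => [/ft //|/eqP ct].
by apply: ft'; case: (sees _ _ _) ct ne; case: (t); case: (t').
Qed.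

(** * Expanded vertices are distinct and few *)

Section Tree.

Variables (d : node n (2 * D - 2)) (s : seq (node n (2 * D - 2))) (i : nat).
Hypothesis T : tree d s i.

Notation X j := (vtx (nth d s j)).
Notation Ty j := (typ (nth d s j)).
Notation P j := (par (nth d s j)).
Notation C j := (via (nth d s j)).

Lemma par_lt j : 0 < j < size s -> P j < j.
Proof. by move=> /(tree_edge T)[+ _ _ _]; nia. Qed.

Lemma sees_via j : 0 < j < size s -> sees phi (X j) (C j).
Proof. by move=> /(tree_edge T)[_ /sees_edge[]]. Qed.

Lemma class_via j : 0 < j < size s -> sees phi u (C j) = ~~ Ty j.
Proof. by move=> /(tree_edge T)[_ _ -> ->]; rewrite negbK. Qed.

(** Induction on the larger index. A common vertex has one type, hence one color outside its class,
    hence one parent vertex, to which the induction hypothesis applies; [tree_inj] then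
    concludes. *)
Lemma vtx_inj j j' : j < i -> j' < i -> X j = X j' -> j = j'.
Proof.
have si := tree_size T.
wlog : j j' / j <= j'.
  move=> W ji ji' E; case: (leqP j j') => [|/ltnW] le; first exact: W.
  by apply/esym/W.
elim/ltn_ind: j' j => j' IH j le ji ji' E.
have tE : Ty j = Ty j'.
  by apply: (@full_typ (X j)); [|rewrite E]; apply: (tree_full T).
(* The root sees no color outside its class, whereas any later node sees the color [via] of its
   parent edge, which is outside. *)
have j0 : 0 < j' -> 0 < j.
  move=> j'0; rewrite lt0n; apply/eqP => j0; subst j.
  have [Xu Tu] := tree_root T.
  have j's : 0 < j' < size s by lia.
  have := class_via j's; have := sees_via j's.
  by rewrite -E -tE Xu Tu => ->.
case: (posnP j') => [|j'p]; first by lia.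
have jp := j0 j'p.
have js : 0 < j < size s by lia.
have j's : 0 < j' < size s by lia.
have cE : C j = C j'.
  apply: (@full_off (X j) (Ty j)); rewrite ?class_via //.
  - exact: (tree_full T).
  - exact: sees_via.
  - by rewrite E; apply: sees_via.
  - by rewrite tE.
have [_ e1 _ _] := tree_edge T js; have [_ e2 _ _] := tree_edge T j's.
have pE : X (P j) = X (P j').
  apply: (mphi (v := X j) (c := C j)); first by rewrite setUC.
  by rewrite E cE setUC.
have := par_lt js; have := par_lt j's => p1 p2.
apply: (tree_inj T) => //.
case: (leqP (P j) (P j')) => le'; first by apply: IH => //; lia.
by apply/esym/IH => //; lia.
Qed.

(** [v] sees exactly the class of type [false], whereas a node of that type is not the root and sees
    its [via] color, which is of the other class. *)
Lemma vtx_neq_v j : j < i -> X j != v.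
Proof.
move=> ji; apply/eqP => E; have si := tree_size T.
have fj := tree_full T ji; rewrite E in fj.
have tj := full_typ fj full_v.
case: (posnP j) => [j0|jp]; first by move: tj; rewrite j0 (tree_root T).2.
have js : 0 < j < size s by lia.
have := class_via js; have := sees_via js.
by rewrite E class_compl tj => /negbTE ->.
Qed.

Lemma tree_index_le : i <= n.
Proof.
have inj : injective (fun j : 'I_i => X j).
  by move=> j j' /vtx_inj E; apply/val_inj/E.
by have := leq_card _ inj; rewrite !card_ord.
Qed.

(** Each of the [i] distinct expanded vertices sees the [D - 1] colors of its class, and the degrees
    sum to twice the number of edges. *)
Lemma tree_edges : i * (D - 1) <= 2 * #|G|.
Proof.
have inj : injective (fun j : 'I_i => X j).
  by move=> j j' /vtx_inj E; apply/val_inj/E.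
rewrite -(handshake sG) -[i in i * _]card_ord -sum_nat_const.
rewrite -(big_imset (fun _ => D - 1) (in2W inj)) /=.
rewrite [leqRHS](bigID [in [set X (val j) | j : 'I_i]]) /=.
apply: leq_trans (leq_addr _ _); apply: leq_sum => y /imsetP[j _ ->].
rewrite -(card_class (Ty j)); apply: leq_trans (@card_sees _ _ G phi _ _).
  apply/subset_leq_card/subsetP => c; rewrite !inE => /eqP.
  exact: (tree_full T).
by move=> f /eqP; rewrite suppphi negbK.
Qed.

(** * Shifting along a branch *)

(** [v] counts as internal: it is an end of the first edge that receives a color, and it sees
    exactly the class of type [false]. *)
Definition internal y t :=
  (y = v /\ t = false) \/ (exists2 j, j < i & y = X j /\ t = Ty j).

Lemma internal_full y t : internal y t -> full y t.
Proof.
by case=> [[-> ->]|[j ji [-> ->]]]; [apply: full_v | apply: (tree_full T)].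
Qed.

(* The uncolored edge has been shifted along the branch that ends at the queue
   index [j], and is now [ab]. *)
Record moving (psi : pcoloring n (2 * D - 2)) (a b : 'I_n) (j : nat) : Prop :=
  Moving {
  mov_le : j <= i;
  mov_b : b = X j;
  mov_a : (j = 0 /\ a = v) \/ (0 < j /\ a = X (P j));
  mov_match : matching psi;
  mov_supp : forall f, (psi f == None) = (f \notin G') || (f == [set a; b]);
  mov_a_class : forall c, sees psi a c -> sees phi u c = ~~ Ty j;
  mov_old : forall y z, y != v -> (forall j', j' < j -> y != X j') ->
    [set y; z] != [set a; b] -> psi [set y; z] = phi [set y; z];
  mov_off : forall y t, internal y t -> forall c c', sees psi y c ->
    sees psi y c' -> sees phi u c = ~~ t -> sees phi u c' = ~~ t -> c = c' }.

Lemma mov_ab psi a b j : moving psi a b j -> [set a; b] \in G'.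
Proof.
move=> M; case: (mov_a M) => -[j0 ->]; rewrite (mov_b M) !inE.
  by rewrite j0 (tree_root T).1 setUC eqxx.
have js : 0 < j < size s by have := tree_size T; have := mov_le M; lia.
have [_ E _ _] := tree_edge T js.
by have := suppphi [set X (P j); X j]; rewrite E => /esym/negbFE ->;
  rewrite orbT.
Qed.

Lemma mov_neq psi a b j : moving psi a b j -> a != b.
Proof. by move/mov_ab; apply: simple_neq simple_insert. Qed.

Lemma mov_proper psi a b j : moving psi a b j -> proper_partial G' psi.
Proof.
move=> M; apply: matching_proper simple_insert _ (mov_match M) => f fG.
by apply/eqP; rewrite (mov_supp M) fG.
Qed.

(** [v] stands in for the parent of the root. *)
Lemma moving_start : moving phi v u 0.
Proof.
have [Xu Tu] := tree_root T.
split=> //.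
- by left.
- move=> f; rewrite suppphi setUC !inE negb_or.
  by case: eqP => [->|]; rewrite ?orbF //= eG.
- by move=> c; rewrite class_compl Tu => /negbTE.
- by move=> y t /internal_full fy c c' *; apply: (full_off fy).
Qed.

(** The color [c] of [bx] is of the class of [b], and [a] sees only colors of the opposite class;
    hence [c] may move to [ab]. *)
Lemma moving_next psi a b j j' (x := X j') (c := C j') : moving psi a b j ->
  j < i -> 0 < j' <= i -> P j' = j ->
  [/\ psi [set b; x] = Some c, [set a; b] != [set b; x],
      ~~ sees (uncolor psi [set b; x]) a c, ~~ sees (uncolor psi [set b; x]) b c
    & moving (shift1 psi [set a; b] [set b; x]) b x j'].
Proof.
move=> M ji /andP[j'0 j'i] pj.
have si := tree_size T.
have j's : 0 < j' < size s by lia.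
have jpos : 0 < j -> 0 < j < size s by lia.
have jj' : j < j' by rewrite -pj par_lt.
have [_ E cl tj'] := tree_edge T j's; rewrite pj -(mov_b M) -/x -/c in E cl tj'.
have bv : b != v by rewrite (mov_b M) vtx_neq_v.
have bX k : k < j -> b != X k.
  move=> kj; rewrite (mov_b M); apply/eqP => /vtx_inj H.
  by have := H ji (ltn_trans kj ji); lia.
have bfull : full b (Ty j) by rewrite (mov_b M); apply: (tree_full T).
have bj : phi [set b; a] <> None -> 0 < j /\ phi [set b; a] = Some (C j).
  case: (mov_a M) => -[j0 ->].
    move/eqP; rewrite suppphi (mov_b M) j0 (tree_root T).1 negbK.
    by rewrite (negbTE eG).
  have js : 0 < j < size s by lia.
  by have [_ Ej _ _] := tree_edge T js; rewrite (mov_b M) setUC Ej.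
(* If [x] were [a], then [bx] would be the edge above [b], which is uncolored in [phi] when [b] is
   the root and otherwise has a color outside the class of [b]. *)
have ne : [set a; b] != [set b; x].
  rewrite setUC; apply/eqP => /set2_inj ax.
  rewrite -ax in E; have [|jp] := bj; first by rewrite E.
  rewrite E => -[cE]; have js : 0 < j < size s by lia.
  by have := class_via js; rewrite -cE cl; case: (Ty j).
(* [b] is expanded, hence neither [v] nor an earlier vertex of the queue, and [bx] still has its
   original color. *)
have Epsi : psi [set b; x] = Some c.
  by rewrite (mov_old M) // eq_sym.
have na : ~~ sees (uncolor psi [set b; x]) a c.
  apply/negP => /sees_uncolor /(mov_a_class M); rewrite cl.
  by case: (Ty j).
have nb := uncolor_unseen (mov_match M) Epsi.
have Esh := shift1E [set a; b] Epsi.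
split=> //; split=> //.
- by right; rewrite pj -(mov_b M).
- by rewrite Esh; apply: matching_set_color => //;
    apply: matching_uncolor (mov_match M).
- move=> f; rewrite ffunE Epsi; case: (f =P [set a; b]) => [->|/eqP fab].
    by rewrite (mov_ab M) (negbTE ne).
  case: (f =P [set b; x]) => [->|_]; first by rewrite eqxx orbT.
  by rewrite (mov_supp M) (negbTE fab).
(* Now [b] sees class colors only: in [phi] its single color outside the class was that of [ab], and
   the root had none. *)
- move=> c' /seesP[z]; rewrite ffunE Epsi; case: eqP => [|/eqP ne1].
    by move=> _ [<-]; rewrite cl tj' negbK.
  case: eqP => [//|/eqP ne2]; rewrite (mov_old M) // => E1.
  rewrite tj' negbK; case: (sees phi u c' =P Ty j) => // nt.
  have nt' : sees phi u c' = ~~ Ty j by case: (sees _ _ _) nt; case: (Ty j).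
  case: (posnP j) => [j0|jp].
    have := nt'; rewrite j0 (tree_root T).2 /= => nu.
    have := (sees_edge E1).1; rewrite (mov_b M) j0 (tree_root T).1.
    by rewrite nu.
  have js := jpos jp.
  have cE : c' = C j.
    apply: (full_off bfull) => //; first exact: (sees_edge E1).1.
      by rewrite (mov_b M); apply: sees_via.
    exact: class_via.
  have [_ Ej _ _] := tree_edge T js.
  case: (mov_a M) => [[j0 _]|[_ aE]]; first by rewrite j0 in jp.
  have za : z = a.
    apply: (mphi (v := b) (c := C j)); first by rewrite -cE.
    by rewrite setUC aE (mov_b M).
  by rewrite za setUC eqxx in ne1.
- move=> y z yv yX ne1.
  have yb : y != b by rewrite (mov_b M); apply: yX.
  have ya : y != a.
    case: (mov_a M) => -[jp ->] //; apply: yX.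
    exact: ltn_trans (par_lt (jpos jp)) jj'.
  rewrite ffunE; case: eqP => [H|/eqP ne2].
    have : y \in [set a; b] by rewrite -H !inE eqxx.
    by rewrite !inE (negbTE ya) (negbTE yb).
  rewrite (negbTE ne1) (mov_old M) // => k kj; apply: yX (ltn_trans kj jj').
(* Only [a] can gain a color, namely [c]. All its other colors are of the opposite class, so that
   [c] is alone in its class there. *)
- move=> y t Iy c1 c2; rewrite Esh => s1 s2 u1 u2.
  have key c' : sees (set_color (uncolor psi [set b; x]) [set a; b] c) y c' ->
      sees phi u c' = ~~ t ->
      sees psi y c' \/ (c' = c /\ y = a).
    move=> /sees_set_color[/sees_uncolor|[-> ]]; first by left.
    rewrite !inE => /orP[]/eqP yE uc; first by right.
    left; rewrite yE; exact: (sees_edge Epsi).1.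
  have aoff c' : y = a -> sees psi y c' -> sees phi u c = ~~ t ->
      sees phi u c' = ~~ t -> False.
    move=> ya; rewrite ya => /(mov_a_class M) uc' <-.
    by rewrite uc' cl; case: (Ty j).
  case: (key _ s1 u1) => [p1|[e1 ya]]; case: (key _ s2 u2) => [p2|[e2 yaa]].
  + exact: (mov_off M Iy).
  + by case: (aoff c1 yaa p1 _ u1); rewrite -e2.
  + by case: (aoff c2 ya p2 _ u2); rewrite -e1.
  + by rewrite e1 e2.
Qed.

(** By [mov_a_class] the whole class of [X i] is free at [a]; it remains to find one of its colors
    free at [b]. If [b] is internal, its type there is the opposite one, since it is not full for
    [Ty i]. Otherwise its colored edges are as in [phi]. *)
Lemma moving_end psi a b : moving psi a b i -> ~ full (X i) (Ty i) ->
  exists c, ~~ sees psi a c && ~~ sees psi b c.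
Proof.
move=> M nf.
have [c uc nc] : exists2 c, sees phi u c = Ty i & ~~ sees psi b c; last first.
  exists c; rewrite nc andbT; apply/negP => /(mov_a_class M).
  by rewrite uc; case: (Ty i).
have [[t [It]]|nI] : (exists t, internal b t /\ t = ~~ Ty i) \/
    (b != v /\ forall j, j < i -> b != X j).
  have Tt y t : internal y t -> y = X i -> t = ~~ Ty i.
    move=> /internal_full ft yE; case: (t =P Ty i) => [E|].
      by case: nf; rewrite -E -yE.
    by case: (t); case: (Ty i).
  case: (b =P v) => [bv|/eqP bv].
    left; have Ib : internal b false by left.
    by exists false; split=> //; apply: Tt Ib (mov_b M).
  case: (boolP [exists j : 'I_i, b == X j]) => [/existsP[j /eqP bj]|].
    have Ib : internal b (Ty j) by right; exists j.
    by left; exists (Ty j); split=> //; apply: Tt Ib (mov_b M).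
  rewrite negb_exists => /forallP H; right; split=> // j ji.
  exact: (H (Ordinal ji)).
- move=> tE; have := card_class (Ty i).
  case: (pickP (fun c => (sees phi u c == Ty i) && ~~ sees psi b c)).
    by move=> c /andP[/eqP uc nc] _; exists c.
  (* The class has [D - 1 > 1] colors. Two of them seen at [b] would be two colors outside the class
     of [b] as an internal vertex. *)
  move=> none cc; have : 1 < #|[set c | sees phi u c == Ty i]| by card_lia.
  move=> /card_gt1P[c1 [c2 [+ + ne]]]; rewrite !inE => /eqP u1 /eqP u2.
  have b1 : sees psi b c1 by have := none c1; rewrite u1 eqxx => /negbFE.
  have b2 : sees psi b c2 by have := none c2; rewrite u2 eqxx => /negbFE.
  have := mov_off M It b1 b2; rewrite tE negbK => /(_ u1 u2) E.
  by rewrite E eqxx in ne.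
- case: nI => bv bX.
  case: (pickP (fun c => (sees phi u c == Ty i) && ~~ sees phi (X i) c)).
    move=> c /andP[/eqP uc nc]; exists c => //; apply: contra nc => /seesP[z E].
    case: ([set b; z] =P [set a; b]) => [H|/eqP H].
      have := mov_supp M [set a; b]; rewrite eqxx orbT -H E //.
    by rewrite (mov_old M) // in E; rewrite -(mov_b M); case: (sees_edge E).
  move=> none; case: nf => c uc; have := none c.
  by rewrite uc eqxx => /negbFE.
Qed.

End Tree.
End Blocked.

(** * Growth of the queue, color by color *)

Section Growth.

Variables (n D : nat) (G : graph n) (phi : pcoloring n (2 * D - 2))
  (u v : 'I_n).

Hypothesis B : blocked_edge G phi u v.

Let D_ge := be_deg B.

Variable d : node n (2 * D - 2).

(* The queue when the colors below [c] at its [i]-th vertex have been handled. *)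
Record growing (s : seq (node n (2 * D - 2))) (i c : nat) (found : bool) :
  Prop :=
  Growing {
  gr_tree : tree phi u d s i;
  gr_size : i * (D - 1) < size s <= i * (2 * D - 2) + c + 1;
  gr_count : ~~ found -> i * (D - 1) +
    #|[set c' : 'I_(2 * D - 2) | (c' < c) &&
      (sees phi u c' == typ (nth d s i))]|
      < size s;
  gr_order : forall j, 0 < j < size s -> let x := nth d s j in
    par x < i \/ par x = i /\ via x < c;
  gr_found : found -> ~ full phi u (vtx (nth d s i)) (typ (nth d s i));
  gr_seen : ~~ found -> forall c' : 'I_(2 * D - 2), c' < c ->
    sees phi u c' = typ (nth d s i) -> sees phi (vtx (nth d s i)) c' }.

(** [d] is both the root and the default element of [nth]. *)
Lemma growing_start : vtx d = u -> typ d = true -> growing [:: d] 0 0 false.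
Proof.
move=> du dt; split=> //=.
- by split=> //= [j|j j']; lia.
- by move=> _; rewrite mul0n add0n ltnS leqn0 cards_eq0; apply/eqP/setP => c;
    rewrite !inE.
- by move=> j; lia.
Qed.

Lemma growing_skip s i (c : 'I_(2 * D - 2)) found : growing s i c found ->
  sees phi u c != typ (nth d s i) -> growing s i c.+1 found.
Proof.
move=> g ne; split.
- exact: gr_tree g.
- by have := gr_size g; lia.
- move=> nf; have := gr_count g nf; congr (_ + _ < _); apply: eq_card => c'.
  rewrite !inE ltnS (leq_eqVlt c' c);
    case: (c' =P c :> nat) => [/val_inj ->|//].
  by rewrite (negbTE ne) !andbF.
- by move=> j js /=; case: (gr_order g js) => [|[]] ; lia.
- exact: gr_found g.
- move=> nf c'; rewrite ltnS leq_eqVlt => /orP[/eqP/val_inj ->|].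
    by move=> E; rewrite E eqxx in ne.
  exact: gr_seen g nf c'.
Qed.

(** The scan of the colors goes on after a missing one is met; the claims that lead to a full vertex
    are dropped from then on. *)
Lemma growing_found s i (c : 'I_(2 * D - 2)) found : growing s i c found ->
  sees phi u c = typ (nth d s i) -> ~~ sees phi (vtx (nth d s i)) c ->
  growing s i c.+1 true.
Proof.
move=> g uc nc; split=> //.
- exact: gr_tree g.
- by have := gr_size g; nat_lia.
- by move=> j js /=; case: (gr_order g js) => [|[]] ; nat_lia.
- by move=> _ /(_ c uc); rewrite (negbTE nc).
Qed.

(** Colors come in increasing order, so that [gr_order] excludes an earlier node with the same
    parent and color; [gr_size] gives the index bound in [tree_edge]. *)
Lemma growing_push s i (c : 'I_(2 * D - 2)) found w : growing s i c found ->
  sees phi u c = typ (nth d s i) -> phi [set vtx (nth d s i); w] = Some c ->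
  growing (rcons s (Node w (~~ typ (nth d s i)) i c)) i c.+1 found.
Proof.
move=> g uc E; have T := gr_tree g.
have is_ := tree_size T.
set x := Node _ _ _ _; set s' := rcons s x.
have old j : j < size s -> nth d s' j = nth d s j by move=> js;
  rewrite nth_rcons js.
have new : nth d s' (size s) = x by rewrite nth_rcons ltnn eqxx.
have sz : size s' = (size s).+1 by rewrite size_rcons.
have split_j j : 0 < j < size s' -> 0 < j < size s \/ j = size s by rewrite sz;
  nat_lia.
split.
- split.
  + by rewrite sz ltnS ltnW.
  + by rewrite old; [apply: tree_root T | nat_lia].
  + move=> j /split_j[js|->] /=.
      have [p1 p2 p3 p4] := tree_edge T js.
      have ps : par (nth d s j) < size s by nia.
      by have /andP[_ js'] := js; rewrite (old j js') (old _ ps).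
    rewrite new /= old //; split=> //; by case/andP: (gr_size g).
  + have D1 j : 0 < j < size s -> par (nth d s j) = i -> via (nth d s j) <> c.
      move=> js pj /(congr1 val) /= cj.
      by have /= := gr_order g js; rewrite pj cj !ltnn => -[|[]].
    move=> j j' /split_j[js|->] /split_j[js'|->] //.
    * by rewrite !old; [apply: (tree_inj T) | nat_lia | nat_lia].
    * by rewrite new old /=; [move=> /(D1 _ js) | nat_lia].
    * rewrite new old /=; last by nat_lia.
      by move=> /esym p /esym; case/(D1 _ js' p).
  + by move=> j ji; rewrite old; [apply: (tree_full T) | nat_lia].
- by rewrite sz; have := gr_size g; nat_lia.
- move=> nf; rewrite sz ltnS old //.
  apply: leq_trans (gr_count g nf); rewrite -addnS leq_add2l.
  rewrite (cardsD1 c) !inE ltnSn uc eqxx /= add1n ltnS.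
  apply/subset_leq_card/subsetP => c'; rewrite !inE ltnS => /and3P[ne le ->].
  by rewrite andbT ltn_neqAle le andbT.
- move=> j /split_j[js|->] /=; last by rewrite new; right.
  by rewrite old; [case: (gr_order g js) => [|[]] | ]; nat_lia.
- by move=> f; rewrite old //; apply: gr_found g f.
- move=> nf c'; rewrite ltnS leq_eqVlt old // => /orP[/eqP/val_inj -> _|].
    by case: (sees_edge E).
  exact: gr_seen g nf c'.
Qed.

(** All [D - 1] colors of the class have produced a node. Hence the queue never runs dry: a vertex
    of index [i.+1] exists. *)
Lemma growing_next s i : growing s i (2 * D - 2) false ->
  growing s i.+1 0 false.
Proof.
move=> g; have T := gr_tree g.
have fi : full phi u (vtx (nth d s i)) (typ (nth d s i)).
  by move=> c; apply: (gr_seen g).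
have sz : i.+1 * (D - 1) < size s.
  have := gr_count g isT.
  rewrite (_ : [set _ | _] = [set c | sees phi u c == typ (nth d s i)]).
    by rewrite (card_class B); nat_lia.
  by apply/setP => c; rewrite !inE ltn_ord.
split=> //.
- split.
  + by apply: leq_ltn_trans sz; nia.
  + exact: tree_root T.
  + exact: tree_edge T.
  + exact: tree_inj T.
  + move=> j; rewrite ltnS leq_eqVlt => /orP[/eqP -> //|ji].
    exact: (tree_full T).
- by rewrite sz; have := gr_size g; nat_lia.
- move=> _; rewrite (_ : #|_| = 0) ?addn0 //.
  by apply/eqP; rewrite cards_eq0; apply/eqP/setP => c; rewrite !inE.
- by move=> j js /=; left; case: (gr_order g js) => [|[]]; nat_lia.
Qed.

End Growth.

(** * Running programs within a time bound *)

(** Evaluation is split into a total value and, in [ok], the absence of overflow, so that values are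
    obtained by computation. *)
Fixpoint ev (s : memory) (e : expr) : nat :=
  match e with
  | Lit k => k
  | Get a i => s a (ev s i)
  | Bin o e1 e2 => binop_val o (ev s e1) (ev s e2)
  end.

Fixpoint ok (W : nat) (s : memory) (e : expr) : Prop :=
  match e with
  | Lit k => k < W
  | Get _ i => ok W s i
  | Bin o e1 e2 => ok W s e1 /\ ok W s e2 /\ binop_val o (ev s e1) (ev s e2) < W
  end.

Lemma eval_ok W s e : ok W s e -> eval W s e = Some (ev s e).
Proof.
elim: e => [k|a i IH|o e1 IH1 e2 IH2] /=.
- by rewrite /word => ->.
- by move=> /IH ->.
- by move=> [/IH1 -> [/IH2 -> lt]]; rewrite /word lt.
Qed.

(** Total correctness with a time bound. In [run_seq] the rest of the program becomes the
    postcondition, so that a program is processed from its first command on. *)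
Definition run (W : nat) (p : cmd) (s : memory) (T : nat) (P : memory -> Prop)
  :=
  exists t s', [/\ exec W p s t s', t <= T & P s'].

Fixpoint writes (p : cmd) : seq nat :=
  match p with
  | Skip => [::]
  | Put a _ _ => [:: a]
  | Seq p1 p2 | If _ p1 p2 => writes p1 ++ writes p2
  | While _ p => writes p
  end.

Lemma exec_frame W p s t s' : exec W p s t s' ->
  forall a j, a \notin writes p -> s' a j = s a j.
Proof.
elim=> {p s t s'} //=.
- by move=> a i e s j x _ _ b k; rewrite inE /upd => /negbTE ->.
- move=> p1 p2 s s1 s2 t1 t2 _ IH1 _ IH2 a j.
  by rewrite mem_cat negb_or => /andP[n1 n2]; rewrite IH2 // IH1.
- move=> b p1 p2 s s' x t _ _ IH a j.
  rewrite mem_cat negb_or => /andP[n1 n2]; apply: IH.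
  by case: ifP.
- by move=> b p s s1 s2 x t1 t2 _ _ _ IH1 _ IH2 a j n; rewrite IH2 // IH1.
Qed.

Lemma run_frame W p s T P : run W p s T P ->
  run W p s T (fun s' => P s' /\ forall a j, a \notin writes p ->
    s' a j = s a j).
Proof.
move=> [t [s' [E le Ps]]]; exists t, s'; split=> //; split=> //.
exact: exec_frame E.
Qed.

Lemma run_impl W p s T T' (P P' : memory -> Prop) : run W p s T P -> T <= T' ->
  (forall s', P s' -> P' s') -> run W p s T' P'.
Proof.
by move=> [t [s' [E le Ps]]] le' PP; exists t, s'; split; auto;
  apply: leq_trans le le'.
Qed.

Lemma run_le W p s T T' (P : memory -> Prop) :
  run W p s T P -> T <= T' -> run W p s T' P.
Proof. by move=> r le; apply: run_impl r le _. Qed.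

Lemma run_skip W s (P : memory -> Prop) : P s -> run W Skip s 1 P.
Proof. by exists 1, s; split=> //; constructor. Qed.

Lemma run_put W a i e s (P : memory -> Prop) : ok W s i -> ok W s e ->
  P (upd s a (ev s i) (ev s e)) -> run W (Put a i e) s (cost i + cost e).+1 P.
Proof.
move=> oi oe Ps; exists (cost i + cost e).+1, (upd s a (ev s i) (ev s e)).
by split=> //; constructor; apply: eval_ok.
Qed.

Lemma run_seq W p1 p2 s T1 T2 P :
  run W p1 s T1 (fun s' => run W p2 s' T2 P) -> run W (Seq p1 p2) s (T1 + T2) P.
Proof.
move=> [t1 [s1 [E1 le1 [t2 [s2 [E2 le2 Ps]]]]]]; exists (t1 + t2), s2.
by split=> //; [apply: ExecSeq E1 E2 | apply: leq_add].
Qed.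

Lemma run_if W b p1 p2 s T P : ok W s b ->
  (ev s b != 0 -> run W p1 s T P) -> (ev s b = 0 -> run W p2 s T P) ->
  run W (If b p1 p2) s (cost b + T).+1 P.
Proof.
move=> ob r1 r2.
have : run W (if ev s b != 0 then p1 else p2) s T P.
  by case: ifP => [|/negbFE/eqP]; auto.
move=> [t [s' [E le Ps]]]; exists (cost b + t).+1, s'; split=> //.
  exact: ExecIf (eval_ok ob) E.
by rewrite ltnS leq_add2l.
Qed.

(** The index [k] of the invariant is a variant: there are at most [k] rounds and [k.+1] tests. *)
Lemma run_while W b p T (I : nat -> memory -> Prop) k s :
  (forall k s, I k s -> ok W s b /\
    (ev s b != 0 -> exists2 k', k' < k & run W p s T (I k'))) ->
  I k s ->
  run W (While b p) s ((cost b + T).+1 * k.+1)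
    (fun s' => ev s' b = 0 /\ exists k', I k' s').
Proof.
move=> step; elim/ltn_ind: k s => k IH s Iks; have [ob sb] := step k s Iks.
case: (eqVneq (ev s b) 0) => [b0|/[dup] bn /sb[k' kk' [t1 [s1 [E1 le1 I1]]]]].
  exists (cost b).+1, s; split; last by split=> //; exists k.
    by apply: ExecWhileEnd; rewrite eval_ok // b0.
  by rewrite mulSnr; nia.
have [t2 [s2 [E2 le2 I2]]] := IH k' kk' s1 I1.
exists (cost b + t1 + t2).+1, s2; split=> //.
  exact: ExecWhile (eval_ok ob) bn E1 E2.
by nia.
Qed.

(** Arrays that the body never writes keep their contents from before the loop, and the invariant
    need not repeat this. *)
Lemma run_while_frame W b p T (I : nat -> memory -> Prop) k s :
  (forall k s', I k s' -> (forall a j, a \notin writes p -> s' a j = s a j) ->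
    ok W s' b /\ (ev s' b != 0 -> exists2 k', k' < k & run W p s' T (I k'))) ->
  I k s ->
  run W (While b p) s ((cost b + T).+1 * k.+1) (fun s' =>
    [/\ ev s' b = 0, forall a j, a \notin writes p ->
      s' a j = s a j & exists k', I k' s']).
Proof.
move=> step Iks.
apply: run_impl (run_while (I := fun k s' =>
  I k s' /\ forall a j, a \notin writes p -> s' a j = s a j) _ (conj Iks _)) _ _
    => //.
- move=> k' s' [Iks' fr]; have [ob sb] := step k' s' Iks' fr;
    split=> // /sb[k'' lt r].
  exists k'' => //; apply: run_impl (run_frame r) _ _ => // s2 [I2 fr2].
  by split=> // a j na; rewrite fr2 // fr.
- by move=> s' [b0 [k' [Ik' fr]]]; split=> //; exists k'.
Qed.

(** * The update programs

    Array 2 holds, in cell [v * q + c] with [q = 2 * D - 2], [w.+1] if [vw] has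
    color [c], and 0 if no edge at [v] has color [c].  Arrays 3 to 6 are the
    search queue: vertex, parent, color of the edge to the parent, type.  Array
    7 is a stack of queue indices.  Every scalar has its own array, so that
    [exec_frame] tells which of them a program preserves. *)

Notation var a := (Get a (Lit 0)).
Notation "a ::= e" := (Put a (Lit 0) e) (at level 70).
Infix ";;;" := Seq (at level 80, right associativity).
Infix "+e" := (Bin Add) (at level 50, left associativity).
Infix "-e" := (Bin Defs.Sub) (at level 50, left associativity).
Infix "*e" := (Bin Mul) (at level 40, left associativity).
Infix "<e" := (Bin Lt) (at level 60).
Infix "=e" := (Bin Eq) (at level 60).

Notation vA := 8.
Notation vB := 9.
Notation vC := 10.
Notation vI := 11.
Notation vTail := 12.
Notation vFound := 13.
Notation vJ := 14.
Notation vK := 15.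
Notation vQ := 16.
Notation vX := 17.

Definition cell v c := v *e var vQ +e c.

(** The product is a conjunction that evaluates both factors; at the end the table is thus also read
    at the color [vQ], which is out of range. *)
Definition search :=
  vC ::= Lit 0 ;;;
  While ((var vC <e var vQ) *e
         (Lit 0 <e (Get 2 (cell (var vA) (var vC)) +e Get 2
           (cell (var vB) (var vC)))))
    (vC ::= var vC +e Lit 1).

Definition assign :=
  Put 2 (cell (var vA) (var vC)) (var vB +e Lit 1) ;;;
  Put 2 (cell (var vB) (var vC)) (var vA +e Lit 1) ;;;
  Put 1 (var vA *e Get 0 (Lit 0) +e var vB) (var vC +e Lit 1) ;;;
  Put 1 (var vB *e Get 0 (Lit 0) +e var vA) (var vC +e Lit 1).

(** The output array is not cleared: it matters at edges of the graph only, and an edge uncolored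
    here is either deleted or colored again. *)
Definition unassign :=
  Put 2 (cell (var vB) (var vC)) (Lit 0) ;;;
    Put 2 (cell (var vX) (var vC)) (Lit 0).

Definition push :=
  Put 3 (var vTail) (Get 2 (cell (Get 3 (var vI)) (var vC)) -e Lit 1) ;;;
  Put 4 (var vTail) (var vI) ;;;
  Put 5 (var vTail) (var vC) ;;;
  Put 6 (var vTail) (Lit 1 -e Get 6 (var vI)) ;;;
  vTail ::= var vTail +e Lit 1.

(** The class of a color is read from the row of [u] in the table, which the search leaves
    unchanged. *)
Definition explore :=
  If ((Lit 0 <e Get 2 (cell (Get 0 (Lit 2)) (var vC))) =e Get 6 (var vI))
    (If (Get 2 (cell (Get 3 (var vI)) (var vC))) push (vFound ::= Lit 1))
    Skip ;;;
  vC ::= var vC +e Lit 1.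

Definition explore_all := vC ::= Lit 0 ;;; While (var vC <e var vQ) explore.

Definition grow_start :=
  Put 3 (Lit 0) (Get 0 (Lit 2)) ;;;
  Put 6 (Lit 0) (Lit 1) ;;;
  vTail ::= Lit 1 ;;;
  vI ::= Lit 0 ;;;
  vFound ::= Lit 0.

(** The index advances even after the successful round, whence the subtraction in [trace]. *)
Definition grow :=
  grow_start ;;;
  While (Lit 1 -e var vFound) (explore_all ;;; vI ::= var vI +e Lit 1).

(** Parents are met from the leaf upwards, while the shifts go from the root downwards; hence the
    stack. *)
Definition trace :=
  vJ ::= var vI -e Lit 1 ;;;
  vK ::= Lit 0 ;;;
  While (var vJ)
    (Put 7 (var vK) (var vJ) ;;;
     vK ::= var vK +e Lit 1 ;;;
     vJ ::= Get 4 (var vJ)).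

Definition pop :=
  vK ::= var vK -e Lit 1 ;;;
  vJ ::= Get 7 (var vK) ;;;
  vC ::= Get 5 (var vJ) ;;;
  vX ::= Get 3 (var vJ).

Definition advance := vA ::= var vB ;;; vB ::= var vX.

Definition move_along :=
  While (var vK) (pop ;;; unassign ;;; assign ;;; advance).

Definition set_palette := vQ ::= Lit 2 *e Get 0 (Lit 1) -e Lit 2.

Definition insertion :=
  (set_palette ;;; vA ::= Get 0 (Lit 3) ;;; vB ::= Get 0 (Lit 2)) ;;;
  search ;;;
  If (var vC =e var vQ) (grow ;;; trace ;;; move_along ;;; search) Skip ;;;
  assign.

Definition deletion :=
  (set_palette ;;; vB ::= Get 0 (Lit 2) ;;; vX ::= Get 0 (Lit 3) ;;;
   vC ::= Get 1 (var vB *e Get 0 (Lit 0) +e var vX) -e Lit 1) ;;;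
  unassign.

(** * Representation of a coloring in memory *)

(** A cell holds a single neighbor, so that the equivalence [rep_nb] contains the matching property.
    [rep_le] covers all cells, including those read out of range by [search]. *)
Record rep n q (s : memory) (psi : pcoloring n q) : Prop := Rep {
  rep_nb : forall (v w : 'I_n) (c : 'I_q),
    (s 2 (v * q + c) == w.+1) = (psi [set v; w] == Some c);
  rep_le : forall j, s 2 j <= n;
  rep_out : forall (u v : 'I_n) c, psi [set u; v] = Some c ->
    s 1 (u * n + v) = c.+1 }.

Lemma cell_inj q (v w c d : nat) : c < q -> d < q ->
  (v * q + c == w * q + d) = (v == w) && (c == d).
Proof.
move=> cq dq; apply/eqP/andP => [E|[/eqP -> /eqP ->] //].
have q0 : 0 < q by apply: leq_ltn_trans cq.
have := congr1 (divn^~ q) E; rewrite !divnMDl // !divn_small // !addn0 => ->.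
by have := congr1 (modn^~ q) E; rewrite !modnMDl !modn_small // => ->.
Qed.

Lemma rep_sees n q s (psi : pcoloring n q) (v : 'I_n) (c : 'I_q) : rep s psi ->
  (s 2 (v * q + c) != 0) = sees psi v c.
Proof.
move=> r; apply/idP/seesP => [|[w /eqP]];
  last by rewrite -(rep_nb r) => /eqP ->.
rewrite -lt0n; case E: (s 2 _) => [//|k] _.
have kn : k < n by have := rep_le r (v * q + c); rewrite E.
by exists (Ordinal kn); apply/eqP; rewrite -(rep_nb r) E.
Qed.

Lemma rep_frame n q s s' (psi : pcoloring n q) : rep s psi ->
  (forall j, s' 1 j = s 1 j) -> (forall j, s' 2 j = s 2 j) -> rep s' psi.
Proof.
move=> r e1 e2; split=> [v w c|j|u v c]; rewrite ?e1 ?e2.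
- exact: rep_nb r v w c.
- exact: rep_le r j.
- exact: rep_out r u v c.
Qed.

Lemma rep_matching n q s (psi : pcoloring n q) : rep s psi -> matching psi.
Proof.
move=> r v w w' c /eqP; rewrite -(rep_nb r) => /eqP E /eqP.
by rewrite -(rep_nb r) E eqSS => /eqP/val_inj.
Qed.

Lemma rep_uncolor n q s (psi : pcoloring n q) (v w : 'I_n) (c : 'I_q) :
  rep s psi -> v != w -> psi [set v; w] = Some c ->
  rep (upd (upd s 2 (v * q + c) 0) 2 (w * q + c) 0) (uncolor psi [set v; w]).
Proof.
move=> r vw E; split=> [x y d|j|x y d]; rewrite ?ffunE /upd /=.
- rewrite !cell_inj //.
  case: (x =P w :> nat) => [xw|xw] /=.
    have {}xw := val_inj xw; subst x; case: (d =P c :> nat) => [dc|dc] /=.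
      have {}dc := val_inj dc; subst d; apply/esym.
      case: (_ =P [set v; w]) => [//|ne]; apply/eqP => E'; apply: ne.
      by rewrite setUC in E; rewrite (rep_matching r E' E) setUC.
    rewrite andbF (rep_nb r); case: (_ =P [set v; w]) => [->|//].
    by rewrite E; apply/eqP => -[cd]; apply: dc; rewrite cd.
  case: (x =P v :> nat) => [xv|xv] /=.
    have {}xv := val_inj xv; subst x; case: (d =P c :> nat) => [dc|dc] /=.
      have {}dc := val_inj dc; subst d; apply/esym.
      case: (_ =P [set v; w]) => [//|ne]; apply/eqP => E'; apply: ne.
      by rewrite (rep_matching r E' E).
    rewrite (rep_nb r); case: (_ =P [set v; w]) => [->|//].
    by rewrite E; apply/eqP => -[cd]; apply: dc; rewrite cd.
  rewrite (rep_nb r); case: (_ =P [set v; w]) => [H|//].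
  have : x \in [set v; w] by rewrite -H !inE eqxx.
  by rewrite !inE => /orP[]/eqP H'; [case: xv | case: xw]; rewrite H'.
- by case: ifP => // _; case: ifP => // _; apply: rep_le r j.
- by case: (_ =P [set v; w]) => // _; apply: rep_out r x y d.
Qed.

Lemma rep_set_color n q s (psi : pcoloring n q) (a b : 'I_n) (c : 'I_q) :
  rep s psi -> a != b -> psi [set a; b] = None ->
  ~~ sees psi a c -> ~~ sees psi b c ->
  rep (upd (upd (upd (upd s 2 (a * q + c) b.+1) 2 (b * q + c) a.+1)
         1 (a * n + b) c.+1) 1 (b * n + a) c.+1)
    (set_color psi [set a; b] c).
Proof.
move=> r ab E na nb; split=> [x y d|j|x y d]; rewrite ?ffunE /upd /=.
- rewrite !cell_inj //.
  have unseen z : ~~ sees psi z c -> psi [set z; y] <> Some c.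
    by move=> /negP H H'; apply: H; case: (sees_edge H').
  case: (x =P b :> nat) => [xb|xb] /=.
    have {}xb := val_inj xb; subst x; case: (d =P c :> nat) => [dc|dc] /=.
      have {}dc := val_inj dc; subst d; rewrite eqSS.
      case: (_ =P [set a; b]) => [|ne].
        by rewrite [[set a; b]]setUC => /set2_inj ->; rewrite !eqxx.
      have -> : (psi [set b; y] == Some c) = false by apply/eqP/unseen.
      by apply/eqP => /val_inj H; apply: ne; rewrite -H setUC.
    rewrite andbF (rep_nb r); case: (_ =P [set a; b]) => [->|//].
    by rewrite E; apply/esym/eqP => -[cd]; apply: dc; rewrite cd.
  case: (x =P a :> nat) => [xa|xa] /=.
    have {}xa := val_inj xa; subst x; case: (d =P c :> nat) => [dc|dc] /=.
      have {}dc := val_inj dc; subst d; rewrite eqSS.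
      case: (_ =P [set a; b]) => [|ne].
        by move=> /set2_inj ->; rewrite !eqxx.
      have -> : (psi [set a; y] == Some c) = false by apply/eqP/unseen.
      by apply/eqP => /val_inj H; apply: ne; rewrite -H.
    rewrite (rep_nb r); case: (_ =P [set a; b]) => [->|//].
    by rewrite E; apply/esym/eqP => -[cd]; apply: dc; rewrite cd.
  rewrite (rep_nb r); case: (_ =P [set a; b]) => [H|//].
  have : x \in [set a; b] by rewrite -H !inE eqxx.
  by rewrite !inE => /orP[]/eqP H'; [case: xa | case: xb]; rewrite H'.
- by case: ifP => // _; case: ifP => // _; apply: rep_le r j.
- rewrite !cell_inj //; case: (_ =P [set a; b]) => [|ne].
    move=> /set2_eqP[] [-> ->] [->]; rewrite !eqxx //=.
    by case: ifP.
  move=> H; case: ifP => [/andP[/eqP/val_inj xb /eqP/val_inj ya]|_].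
    by case: ne; rewrite xb ya setUC.
  case: ifP => [/andP[/eqP/val_inj xa /eqP/val_inj yb]|_].
    by case: ne; rewrite xa yb.
  exact: rep_out r x y d H.
Qed.

(** * Word bounds and the elementary routines *)

Section Words.

Variables (n D W : nat).

(** Room for the addresses, of order [n * (n + D)], for the counters, and for the queue length, of
    order [n * D]. *)
Definition large_words := 36 * ((n + D) * (n + D)) <= W.

Hypotheses (D_ge : 4 <= D) (HW : large_words).

Lemma small_lt k : k <= 20 * (n + D) -> k < W.
Proof. move: HW; rewrite /large_words; nia. Qed.

Lemma pair_lt v c m : v <= n + 1 -> m <= n + 2 * D -> c <= n + 2 * D ->
  v * m + c < W.
Proof.
move=> hv hm hc; have := leq_mul hv hm; move: HW; rewrite /large_words.
move: (v * m) => x; nia.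
Qed.

Lemma ok_cell s v c : s vQ 0 = 2 * D - 2 -> ok W s v -> ok W s c ->
  ev s v <= n -> ev s c <= 2 * D -> ok W s (cell v c).
Proof.
move=> sq ov oc hv hc /=; rewrite sq.
have w0 : 0 < W by apply: small_lt; lia.
have h1 := @pair_lt (ev s v) 0 (2 * D - 2);
  have h2 := @pair_lt (ev s v) (ev s c) (2 * D - 2).
rewrite addn0 in h1; do !split=> //; [apply: h1|apply: h2]; lia.
Qed.

Lemma one_lt : 1 < W. Proof. by apply: small_lt; lia. Qed.

Lemma bool_lt (b : bool) : b < W.
Proof. by apply: leq_ltn_trans one_lt; case: b. Qed.

Lemma ok_lit s k : k <= n + D -> ok W s (Lit k).
Proof. by move=> kn; apply: small_lt; lia. Qed.

Lemma ok_var s a : ok W s (var a). Proof. exact: ltnW one_lt. Qed.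

Lemma ok_get s a i : ok W s i -> ok W s (Get a i). Proof. by []. Qed.

Lemma ok_lt s e1 e2 : ok W s e1 -> ok W s e2 -> ok W s (e1 <e e2).
Proof. by move=> o1 o2; do !split=> //; apply: bool_lt. Qed.

Lemma ok_eq s e1 e2 : ok W s e1 -> ok W s e2 -> ok W s (e1 =e e2).
Proof. by move=> o1 o2; do !split=> //; apply: bool_lt. Qed.

Lemma ok_add s e1 e2 : ok W s e1 -> ok W s e2 ->
  ev s e1 + ev s e2 <= 20 * (n + D) ->
  ok W s (e1 +e e2).
Proof. by move=> o1 o2 le; do !split=> //; apply: small_lt. Qed.

Lemma ok_succ s e : ok W s e -> ev s e <= 3 * (n + D) -> ok W s (e +e Lit 1).
Proof. by move=> o le; apply: ok_add => //=; [apply: one_lt | lia]. Qed.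

Lemma ok_sub s e1 e2 : ok W s e1 -> ok W s e2 ->
  ev s e1 - ev s e2 <= 20 * (n + D) ->
  ok W s (e1 -e e2).
Proof. by move=> o1 o2 le; do !split=> //; apply: small_lt. Qed.

(** Every color passed over is seen at one of the ends; hence there are at most [K] rounds, however
    large the palette. The result [2 * D - 2] means that no color is free. *)
Lemma run_search s (psi : pcoloring n (2 * D - 2)) (a b : 'I_n) K :
  rep s psi -> s vA 0 = a -> s vB 0 = b -> s vQ 0 = 2 * D - 2 ->
  #|[set c | sees psi a c]| + #|[set c | sees psi b c]| <= K ->
  run W search s (40 * K.+1)
    (fun s' => exists c, [/\ s' vC 0 = c, c <= 2 * D - 2,
    forall c' : 'I_(2 * D - 2), c' < c -> sees psi a c' || sees psi b c'
    & forall c' : 'I_(2 * D - 2), c' = c :> nat ->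
      ~~ sees psi a c' && ~~ sees psi b c']).
Proof.
move=> r sa sb sq cK.
have an := ltn_ord a; have bn := ltn_ord b.
have w1 : 1 < W by apply: small_lt; lia.
have w0 := ltnW w1.
pose J (s' : memory) := rep s' psi /\
  [/\ s' vA 0 = a, s' vB 0 = b & s' vQ 0 = 2 * D - 2].
pose I (k : nat) (s' : memory) := J s' /\ exists c,
  [/\ s' vC 0 = c, c <= 2 * D - 2, c + k = K &
  forall c' : 'I_(2 * D - 2), c' < c -> sees psi a c' || sees psi b c'].
have cond k s' : I k s' -> ok W s' ((var vC <e var vQ) *e
         (Lit 0 <e (Get 2 (cell (var vA) (var vC)) +e Get 2
           (cell (var vB) (var vC))))).
  move=> [[r' [sa' sb' sq']] [c [sc cq _ _]]].
  have oA : ok W s' (cell (var vA) (var vC)).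
    by apply: ok_cell => //=; rewrite ?sa' ?sc; lia.
  have oB : ok W s' (cell (var vB) (var vC)).
    by apply: ok_cell => //=; rewrite ?sb' ?sc; lia.
  split; last split.
  - by apply: ok_lt; apply: ok_var.
  - apply: ok_lt; first by apply: ok_lit.
    apply: ok_add => //.
    have := rep_le r' (ev s' (cell (var vA) (var vC))).
    have := rep_le r' (ev s' (cell (var vB) (var vC))) => /=; lia.
  - by rewrite /= mulnb; apply: bool_lt.
apply: run_impl.
- apply: run_seq; apply: run_put => //.
  apply: (@run_while W _ _ 6 I K); last first.
    split; last by exists 0.
    by split; [apply: (rep_frame r) => j | split].
  move=> k s' H; split; first exact: cond H.
  case: H => -[r' [sa' sb' sq']] [c [sc cq ck seen]].
  rewrite [ev _ _]/= sc sa' sb' sq' muln_eq0 negb_or !eqb0 !negbK addn_gt0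
    !lt0n.
  case/andP=> cq'; have [o oc] : exists o : 'I_(2 * D - 2),
    o = c :> nat by exists (Ordinal cq').
  rewrite -oc !(rep_sees _ _ r') => so.
  have seen' (c' : 'I_(2 * D - 2)) : c' < c.+1 ->
    sees psi a c' || sees psi b c'.
    rewrite ltnS leq_eqVlt => /orP[/eqP E|]; last exact: seen.
    by have -> : c' = o by apply: val_inj; rewrite /= oc.
  have cK' : c < K.
    apply: leq_trans cK; rewrite -{1}(card_below cq').
    apply: leq_trans (leq_card_setU _ _); apply/subset_leq_card/subsetP => c'.
    by rewrite !inE => /seen'.
  exists (K - c.+1); first by lia.
  apply: run_put => //=; first by rewrite sc; split=> //; split=> //;
    apply: small_lt; lia.
  rewrite sc; split.
    by split; [apply: (rep_frame r') => j | split].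
  by exists c.+1; split=> //; [rewrite /upd /= addn1 | lia].
- rewrite /=; nia.
move=> s' [+ [k [[r' [sa' sb' sq']] [c [sc cq _ seen]]]]].
move=> E; exists c; split=> // c' cc'; move: E.
rewrite [ev _ _]/= sc sa' sb' sq' -cc' ltn_ord mul1n => /eqP;
  rewrite eqb0 -leqNgt leqn0 addn_eq0.
by rewrite -[X in X && _]negbK -[X in _ && X]negbK !(rep_sees _ _ r').
Qed.

Lemma run_assign s (psi : pcoloring n (2 * D - 2)) (a b : 'I_n)
  (c : 'I_(2 * D - 2)) :
  rep s psi -> s 0 0 = n -> s vA 0 = a -> s vB 0 = b -> s vC 0 = c ->
  s vQ 0 = 2 * D - 2 -> a != b -> psi [set a; b] = None ->
  ~~ sees psi a c -> ~~ sees psi b c ->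
  run W assign s 60 (fun s' => rep s' (set_color psi [set a; b] c)).
Proof.
move=> r sn sa sb sc sq ab E na nb.
have an := ltn_ord a; have bn := ltn_ord b; have cn := ltn_ord c.
have R := rep_set_color r ab E na nb.
have w0 : 0 < W := ltnW one_lt.
apply: run_le.
- apply: run_seq; apply: run_put.
    by apply: ok_cell => //=; rewrite ?sa ?sc; lia.
    by apply: ok_succ => //=; rewrite sb; lia.
  apply: run_seq; apply: run_put.
    by apply: ok_cell => //=; rewrite /upd /= ?sb ?sc; lia.
    by apply: ok_succ => //=; rewrite /upd /= sa; lia.
  apply: run_seq; apply: run_put.
    rewrite /= /upd /= sa sn sb; do !split=> //; last by apply: pair_lt; lia.
    by rewrite -[_ * _]addn0; apply: pair_lt; lia.
    by apply: ok_succ => //=; rewrite /upd /= sc; lia.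
  apply: run_put.
    rewrite /= /upd /= sa sn sb; do !split=> //; last by apply: pair_lt; lia.
    by rewrite -[_ * _]addn0; apply: pair_lt; lia.
    by apply: ok_succ => //=; rewrite /upd /= sc; lia.
  by apply: (rep_frame R) => j; rewrite /upd /= sa sb sc ?sn ?sq !addn1.
by [].
Qed.

Lemma run_unassign s (psi : pcoloring n (2 * D - 2)) (b x : 'I_n)
  (c : 'I_(2 * D - 2)) :
  rep s psi -> s vB 0 = b -> s vX 0 = x -> s vC 0 = c ->
  s vQ 0 = 2 * D - 2 -> b != x -> psi [set b; x] = Some c ->
  run W unassign s 40 (fun s' => rep s' (uncolor psi [set b; x])).
Proof.
move=> r sb sx sc sq bx E.
have bn := ltn_ord b; have xn := ltn_ord x; have cn := ltn_ord c.
have R := rep_uncolor r bx E.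
have w0 : 0 < W := ltnW one_lt.
apply: run_le.
- apply: run_seq; apply: run_put => //.
    by apply: ok_cell => //=; rewrite ?sb ?sc; lia.
  apply: run_put => //.
    by apply: ok_cell => //=; rewrite /upd /= ?sx ?sc; lia.
  by apply: (rep_frame R) => j; rewrite /upd /= ?sb ?sc ?sx ?sq.
by [].
Qed.

End Words.

(** * The search and the shifts as executed by the program *)

Section Search.

Variables (n D W : nat) (G : graph n) (phi : pcoloring n (2 * D - 2))
  (u v : 'I_n).

Hypotheses (B : blocked_edge G phi u v) (HW : large_words n D W).

Let D_ge := be_deg B.

Variable d : node n (2 * D - 2).

Hypotheses (du : vtx d = u) (dt : typ d = true).

Definition queue (s : memory) (qs : seq (node n (2 * D - 2))) :=
  forall j, j < size qs ->
    [/\ s 3 j = vtx (nth d qs j), s 6 j = typ (nth d qs j) &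
    0 < j -> s 4 j = par (nth d qs j) /\ s 5 j = via (nth d qs j)].

Record exploring (s : memory) (qs : seq (node n (2 * D - 2))) (i c : nat)
    (found : bool) : Prop := Exploring {
  ex_grow : growing phi u d qs i c found;
  ex_rep : rep s phi;
  ex_queue : queue s qs;
  ex_tail : s vTail 0 = size qs;
  ex_index : s vI 0 = i;
  ex_color : s vC 0 = c;
  ex_found : s vFound 0 = found;
  ex_palette : s vQ 0 = 2 * D - 2;
  ex_root : s 0 2 = u }.

Lemma eqn_bool (b b' : bool) : (b == b' :> nat) = (b == b').
Proof. by case: b; case: b'. Qed.

Lemma run_push s qs i (c : 'I_(2 * D - 2)) found : exploring s qs i c found ->
  sees phi u c = typ (nth d qs i) -> sees phi (vtx (nth d qs i)) c ->
  run W push s 60 (fun s' => exists qs',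
    exploring (upd s' vC 0 c.+1) qs' i c.+1 found).
Proof.
move=> E uc /seesP[w xw].
have g := ex_grow E; have T := gr_tree g.
have i_n := tree_index_le B T.
have iq := tree_size T.
have [q3 q6 q4] := ex_queue E iq.
have [[[et ei] ec] eq] := (ex_tail E, ex_index E, ex_color E, ex_palette E).
have cn := ltn_ord c; have wn := ltn_ord w;
  have xn := ltn_ord (vtx (nth d qs i)).
have nbw : s 2 (vtx (nth d qs i) * (2 * D - 2) + c) = w.+1.
  by apply/eqP; rewrite (rep_nb (ex_rep E)) xw.
(* The upper bound in [gr_size] keeps the queue addresses within a word. *)
have qsz : size qs + 1 < W.
  have [_ le] := andP (gr_size g);
    apply: leq_ltn_trans
    (pair_lt D_ge HW (v := i) (m := 2 * D - 2) (c := c + 2) _ _ _); nat_lia.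
have w1 := one_lt D_ge HW.
have w0 : 0 < W := ltnW w1.
have tq : typ (nth d qs i) <= 1 by case: (typ _).
apply: run_le.
- apply: run_seq; apply: run_put => //.
    apply: (ok_sub D_ge HW) => //;
      first by apply/ok_get/(ok_cell D_ge HW) => //=; rewrite ?ei ?q3 ?ec;
      nat_lia.
    rewrite [ev s (Get 2 _)]/= eq ei ec q3 nbw /=; nat_lia.
  apply: run_seq; apply: run_put => //.
  apply: run_seq; apply: run_put => //.
  apply: run_seq; apply: run_put => //.
    by apply: (ok_sub D_ge HW) => //=; rewrite /upd /=; nat_lia.
  apply: run_put => //; first by do !split=> //=; rewrite /upd /= et.
  exists (rcons qs (Node w (~~ typ (nth d qs i)) i c)); split;
    rewrite ?size_rcons.
  + by apply: growing_push uc xw; try exact: g; try exact: B.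
  + by apply: (rep_frame (ex_rep E)) => j; rewrite /upd /=.
  + move=> j; rewrite size_rcons ltnS /upd /= et ei ec eq q3 nbw nth_rcons.
    case: (ltngtP j (size qs)) => // [jq _|-> _] /=.
      by have := ex_queue E jq; rewrite ?(ltn_eqF jq).
    rewrite subn1; split=> //.
    by rewrite q6; case: (typ _).
  + by rewrite /upd /= et addn1.
  + by rewrite /upd /=.
  + by rewrite /upd /=.
  + by rewrite /upd /= (ex_found E).
  + by rewrite /upd /=.
  + by rewrite /upd /= (ex_root E).
by [].
Qed.
Lemma exploring_color s qs i c found c' : exploring s qs i c found ->
  growing phi u d qs i c' found -> exploring (upd s vC 0 c') qs i c' found.
Proof.
move=> [g r q et ei ec ef eq er] g'; split=> //; rewrite /upd //=.
exact: rep_frame r _ _.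
Qed.

Lemma run_explore s qs i (c : 'I_(2 * D - 2)) found :
  exploring s qs i c found ->
  run W explore s 110
    (fun s' => exists qs' found', exploring s' qs' i c.+1 found').
Proof.
move=> E; have g := ex_grow E; have T := gr_tree g.
have [q3 q6 q4] := ex_queue E (tree_size T).
have [[ei ec] eq] := (ex_index E, ex_color E, ex_palette E).
have er := ex_root E.
have cn := ltn_ord c; have un := ltn_ord u;
  have xn := ltn_ord (vtx (nth d qs i)).
have ov := ok_var D_ge HW.
have w1 := one_lt D_ge HW.
have w0 : 0 < W := ltnW w1.
have /run_frame H : run W
  (If ((Lit 0 <e Get 2 (cell (Get 0 (Lit 2)) (var vC))) =e Get 6 (var vI))
    (If (Get 2 (cell (Get 3 (var vI)) (var vC))) push (vFound ::= Lit 1))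
    Skip) s 95 (fun s' => exists qs' found',
      exploring (upd s' vC 0 c.+1) qs' i c.+1 found').
  apply: run_le.
  - apply: (@run_if _ _ _ _ _ 75).
    + apply: (ok_eq D_ge HW); last exact: ov.
      apply: (ok_lt D_ge HW); first by apply: (ok_lit D_ge HW).
      apply/ok_get/(ok_cell D_ge HW) => //=; rewrite ?ec ?er; try nat_lia.
      by apply: (small_lt D_ge HW); nat_lia.
    + rewrite [ev _ _]/= eq er ec ei q6 lt0n (rep_sees _ _ (ex_rep E)) eqb0
        negbK eqn_bool.
      move=> /eqP uc; apply: run_le.
        apply: (@run_if _ _ _ _ _ 60).
        * by apply/ok_get/(ok_cell D_ge HW) => //=; rewrite ?ei ?ec ?q3;
            nat_lia.
        * rewrite [ev _ _]/= eq ei ec q3 (rep_sees _ _ (ex_rep E)) => xc.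
          apply: run_impl (run_push E uc xc) _ _ => // s' [qs' E'].
          by exists qs', found.
        * rewrite [ev _ _]/= eq ei ec q3 => /eqP.
          rewrite -[_ == 0]negbK (rep_sees _ _ (ex_rep E)) => xc.
          apply: run_le; first apply: run_put => //=.
            exists qs, true; have g' := growing_found B g uc xc.
            split=> //; try by rewrite /upd /=.
            + by apply: (rep_frame (ex_rep E)) => j.
            + exact: ex_queue E.
            + exact: ex_tail E.
          by [].
      by [].
    + rewrite [ev _ _]/= eq er ec ei q6 lt0n (rep_sees _ _ (ex_rep E)) eqn_bool.
      move=> /eqP; rewrite eqb0 => uc; apply: run_le; first apply: run_skip.
        exists qs, found; apply: (exploring_color E).
        exact: (growing_skip B g uc).
      by [].
  - by [].
apply: run_le.
- apply: run_seq; apply: run_impl H (leqnn _) _ => s' [[qs' [f' E']] fr].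
  have c' : s' vC 0 = c by rewrite fr.
  apply: run_put => //=; first by do !split=> //=; apply: (small_lt D_ge HW);
    nat_lia.
  by rewrite c' addn1; exists qs', f'.
by [].
Qed.

Lemma run_explore_all s qs i : exploring (upd s vC 0 0) qs i 0 false ->
  run W explore_all s (220 * (2 * D - 2).+1) (fun s' => exists qs' found',
    exploring s' qs' i (2 * D - 2) found').
Proof.
move=> E; have w0 : 0 < W := ltnW (one_lt D_ge HW).
pose I k s' := exists qs' c found',
  [/\ c + k = 2 * D - 2 & exploring s' qs' i c found'].
apply: run_impl.
- apply: run_seq; apply: run_put => //.
  apply: (@run_while _ _ _ 110 I (2 * D - 2)); last by exists qs, 0, false.
  move=> k s' [qs' [c [f' [ck E']]]]; split.
    by apply: (ok_lt D_ge HW); apply: (ok_var D_ge HW).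
  rewrite [ev _ _]/= (ex_palette E') (ex_color E') eqb0 negbK => cq.
  exists (2 * D - 2 - c.+1); first by lia.
  apply: run_impl (run_explore (c := Ordinal cq) E') _ _ => // s2 [qs2 [f2 E2]].
  by exists qs2, c.+1, f2; split=> //; lia.
- by rewrite /=; lia.
move=> s' [+ [k [qs' [c [f' [ck E']]]]]].
rewrite [ev _ _]/= (ex_palette E') (ex_color E') => /eqP; rewrite eqb0 => nc.
have cE : c = 2 * D - 2 by lia.
by exists qs', f'; rewrite cE in E'.
Qed.

(** [u] sees a whole class. This pays for the part of the running time that is linear in [D]. *)
Lemma card_class_le : D - 1 <= #|G|.
Proof.
rewrite -(card_class B true); apply: leq_trans (degree_le G u).
apply: leq_trans (@card_sees _ _ G phi u _).
  by apply/subset_leq_card/subsetP => c; rewrite !inE => /eqP.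
by move=> f /eqP; rewrite (be_supp B) negbK.
Qed.

Record explored (s : memory) (qs : seq (node n (2 * D - 2))) (i : nat) : Prop :=
  Explored {
  xd_tree : tree phi u d qs i;
  xd_open : ~ full phi u (vtx (nth d qs i)) (typ (nth d qs i));
  xd_queue : queue s qs;
  xd_index : s vI 0 = i.+1 }.

(** By [tree_edges] there are at most [K] rounds, each of cost [O(D)]. The product is [O(#|G| + D)],
    and [card_class_le] absorbs [D]. *)
Lemma run_grow s : rep s phi -> s vQ 0 = 2 * D - 2 -> s 0 2 = u ->
  run W grow s (4000 * #|G|.+1) (fun s' => exists qs i, explored s' qs i).
Proof.
move=> r eq er.
have w1 := one_lt D_ge HW.
have w0 : 0 < W := ltnW w1.
have w2 : 2 < W by apply: (small_lt D_ge HW); nat_lia.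
have m_ge := card_class_le.
pose K := (2 * #|G|) %/ (D - 1) + 1.
pose T := 220 * (2 * D - 2).+1 + 10.
pose I k s' := (s' vFound 0 = 0 /\ exists qs i,
    i + k = K /\ exploring (upd s' vC 0 0) qs i 0 false) \/
  (s' vFound 0 = 1 /\ exists qs i, explored s' qs i).
have index_lt qs i : tree phi u d qs i -> i < K.
  move=> T'; rewrite /K addn1 ltnS leq_divRL; last by nat_lia.
  exact: (tree_edges B T').
have /run_frame H0 : run W grow_start s 30 (fun s' =>
    exploring (upd s' vC 0 0) [:: d] 0 0 false).
  apply: run_le.
  - do 4 (apply: run_seq; apply: run_put => //); apply: run_put => //.
    split=> //; try by rewrite /upd /=.
    + exact: (growing_start B du dt).
    + by apply: (rep_frame r) => j; rewrite /upd.
    + by case=> // _; rewrite /upd /= er du dt.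
  - by [].
apply: run_impl.
- apply: run_seq; apply: run_impl H0 (leqnn _) _ => s1 [E1 fr1].
  apply: (@run_while _ _ _ T I K); last first.
    by left; split; [apply: ex_found E1 | exists [:: d], 0].
  move=> k s' Iks; split.
    by apply: (ok_sub D_ge HW) => //=; lia.
  case: Iks => [[ef [qs [i [ik E]]]]|[ef _]]; rewrite [ev _ _]/= ef // => _.
  have iK := index_lt _ _ (gr_tree (ex_grow E)).
  exists (K - i.+1); first by nat_lia.
  apply: run_le.
  - apply: run_seq; apply: run_impl (run_explore_all E) (leqnn _) _.
    move=> s2 [qs2 [f2 E2]].
    have T2 := gr_tree (ex_grow E2).
    have i_n := tree_index_le B T2.
    apply: run_put => //.
      by apply: (ok_succ D_ge HW); rewrite //= (ex_index E2); nat_lia.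
    rewrite [ev _ (Lit _)]/= [ev _ (_ +e _)]/= (ex_index E2) addn1.
    case: f2 E2 => E2.
      right; split; first by rewrite /upd /= (ex_found E2).
      exists qs2, i; split=> //; last exact: ex_queue E2.
      exact: gr_found (ex_grow E2) isT.
    left; split; first by rewrite /upd /= (ex_found E2).
    exists qs2, i.+1; split; first by nat_lia.
    split; try by rewrite /upd /=.
    + exact: (growing_next B (ex_grow E2)).
    + by apply: (rep_frame (ex_rep E2)) => j; rewrite /upd.
    + exact: ex_queue E2.
    + by rewrite /upd /= (ex_tail E2).
    + by rewrite /upd /= (ex_found E2).
    + by rewrite /upd /= (ex_palette E2).
    + by rewrite /upd /= (ex_root E2).
  - by rewrite /T /=; nat_lia.
- have KD : K * (D - 1) <= 2 * #|G| + (D - 1).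
    by rewrite /K mulnDl mul1n leq_add2r leq_trunc_div.
  have : K.+1 * (D - 1) <= 2 * #|G| + 2 * (D - 1) by nat_lia.
  have TD : T <= 300 * (D - 1) * 3 by rewrite /T; nat_lia.
  rewrite [cost _]/=; move: K.+1 => K' KD'.
  have : (4 + T).+1 * K' <= 902 * ((D - 1) * K') by rewrite mulnA leq_mul2r;
    nat_lia.
  nat_lia.
move=> s' [e0 [k [[ef _]|[_ //]]]].
by move: e0; rewrite /= ef.
Qed.

Definition stack (s : memory) (st : seq nat) :=
  forall k, k < size st -> s 7 k = nth 0 (rev st) k.

Definition branch (qs : seq (node n (2 * D - 2))) (i j : nat) (st : seq nat) :=
  [/\ path (fun x y => (0 < y) && (par (nth d qs y) == x)) j st, last j st = i
    & all (fun y => y <= i) st].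

(** A step to the parent divides the index by at least [D - 1], so that [(D - 1) ^ size st * j <= i]
    is invariant. It says nothing once [j] is 0; the bound with exponent [(size st).-1] comes from
    the last positive [j]. *)
Lemma run_trace s qs i : explored s qs i ->
  run W trace s (100 * i.+1) (fun s' => exists st, [/\ branch qs i 0 st,
    stack s' st, s' vK 0 = size st, size st <= i
    & 0 < size st -> (D - 1) ^ (size st).-1 <= i]).
Proof.
clear dt; move=> [T _ q ei].
have w1 := one_lt D_ge HW.
have w0 : 0 < W := ltnW w1.
have i_n := tree_index_le B T.
have iq := tree_size T.
pose I j s' := s' vJ 0 = j /\ exists st, [/\ branch qs i j st, stack s' st,
  s' vK 0 = size st, size st + j <= i &
  (D - 1) ^ (size st) * j <= i /\ (0 < size st -> (D - 1) ^ (size st).-1 <= i)].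
apply: run_impl.
- apply: run_seq; apply: run_put => //.
    by apply: (ok_sub D_ge HW) => //=; rewrite ei; lia.
  apply: run_seq; apply: run_put => //.
  apply: (@run_while_frame _ _ _ 50 I i); last first.
    rewrite /I /upd /= ei; split; first by lia.
    by exists [::]; split=> //; split=> //; rewrite mul1n.
  move=> j s' [ej [st [[pst lst ast] sst ek szj [p1 p2]]]] fr.
  split; first exact: (ok_var D_ge HW).
  rewrite [ev _ _]/= ej => j0.
  have js : 0 < j < size qs by lia.
  have jq : j < size qs by lia.
  have [q3 q6 /(_ _)[|q4 q5]] := q j jq; first by lia.
  have pj := par_lt B T js.
  have [pD _ _ _] := tree_edge T js.
  exists (par (nth d qs j)) => //.
  apply: run_le.
  - do 2 (apply: run_seq; apply: run_put => //).
      by apply: (ok_succ D_ge HW); rewrite //= /upd /= ek; lia.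
    apply: run_put => //.
    rewrite /I; split; first by rewrite /upd /= ej fr // /upd /=.
    exists (j :: st); split.
    + by split; rewrite //= ?lt0n ?j0 ?eqxx ?pst //; apply/andP; split=> //;
        lia.
    + move=> k /=; rewrite /upd /= ek ej rev_cons nth_rcons size_rev ltnS.
      case: ltngtP => // kst _; exact: sst.
    + by rewrite /upd /= ek addn1.
    + by rewrite /=; lia.
    + have e1 : (D - 1) ^ size st <= i by apply: leq_trans p1;
        rewrite leq_pmulr // lt0n.
      split=> //=; rewrite expnS; apply: leq_trans p1.
      by rewrite -mulnA mulnCA leq_mul2l mulnC (ltnW pD) orbT.
  - by [].
- by rewrite /=; lia.
move=> s' [+ _ [j [ej [st [b st' ek szj [_ p2]]]]]].
rewrite [ev _ _]/= ej => j0; exists st; rewrite -{1}j0; split=> //.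
by lia.
Qed.

Lemma run_pop s k j c x : s vK 0 = k.+1 -> k < W -> s 7 k = j -> s 5 j = c ->
  s 3 j = x ->
  run W pop s 40 (fun s' => [/\ s' vK 0 = k, s' vC 0 = c & s' vX 0 = x]).
Proof.
move=> ek kW e7 e5 e3; have w1 := one_lt D_ge HW; have w0 : 0 < W := ltnW w1.
apply: run_le.
- apply: run_seq; apply: run_put => //; first by rewrite /= ek subn1.
  do 2 (apply: run_seq; apply: run_put => //); apply: run_put => //.
  by split; rewrite /upd /= ek subn1 //= e7 ?e5 ?e3.
by [].
Qed.

Lemma run_advance s b x : s vB 0 = b -> s vX 0 = x ->
  run W advance s 20 (fun s' => s' vA 0 = b /\ s' vB 0 = x).
Proof.
move=> eb ex; have w0 : 0 < W := ltnW (one_lt D_ge HW).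
apply: run_le.
- by apply: run_seq; apply: run_put => //; apply: run_put => //;
    rewrite /upd /= eb ex.
by [].
Qed.

Let G' := [set u; v] |: G.

(** A round is one [shift1], legal by [moving_next]; [p] records the edges shifted to so far. *)
Lemma run_move_along s qs i st : explored s qs i -> rep s phi -> s vA 0 = v ->
  s vB 0 = u ->
  s vQ 0 = 2 * D - 2 -> s 0 0 = n -> branch qs i 0 st -> stack s st ->
    s vK 0 = size st ->
  size st <= i ->
  run W move_along s (300 * (size st).+1) (fun s' => exists psi (a b : 'I_n) p,
    [/\ rep s' psi, s' vA 0 = a,
      s' vB 0 = b & moving G phi u v d qs i psi a b i] /\
    [/\ shiftable G' phi [set u; v] p, shift phi [set u; v] p = psi,
       last [set u; v] p = [set a; b] & size p = size st]).
Proof.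
clear dt; move=> X r ea eb eq en br sst ek szi; have T := xd_tree X.
have i_n := tree_index_le B T.
have w0 : 0 < W := ltnW (one_lt D_ge HW).
pose I k s' := exists psi (a b : 'I_n) j p st',
  [/\ rep s' psi, s' vA 0 = a, s' vB 0 = b,
    moving G phi u v d qs i psi a b j & branch qs i j st'] /\
  [/\ stack s' st', s' vK 0 = size st', size st' = k & size p + k = size st] /\
  [/\ shiftable G' phi [set u; v] p, shift phi [set u; v] p = psi &
       last [set u; v] p = [set a; b]].
apply: run_impl.
- apply: (@run_while_frame _ _ _ 200 I (size st)); last first.
    exists phi, v, u, 0, [::], st; split; first by split=> //;
      apply: (moving_start B T).
    split=> //; split=> //=; last by rewrite setUC.
    by split=> //; apply/eqP; rewrite (be_supp B) (be_notin B).
  move=> k s' [psi [a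
    [b [j [p [st' [[r' ea' eb' M [pst lst ast]]
    [[sst' ek' szk szp] [sh1 sh2 sh3]]]]]]]]] fr.
  split=> //; rewrite [ev _ _]/= ek' => st0.
  case: st' => [//|j' st'] in pst lst ast sst' ek' szk st0 *.
  move: pst ast => /= /andP[/andP[j'0 /eqP pj]] pst /andP[j'i ast].
  have iq := tree_size T.
  have j's : 0 < j' < size qs by lia.
  have jj' : j < j' by rewrite -pj (par_lt B T).
  have [q3 _ /(_ j'0)[_ q5]] := xd_queue X (proj2 (andP j's)).
  have [Epsi ne na nb M'] :=
    moving_next B T M (leq_trans jj' j'i) (introT andP (conj j'0 j'i)) pj.
  set x := vtx _ in Epsi ne na nb M' q3; set c := via _ in Epsi na nb q5.
  exists (size st'); first by rewrite -szk.
  have bx : b != x := mov_neq B T M'.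
  have ab : a != b := mov_neq B T M.
  have Eab : uncolor psi [set b; x] [set a; b] = None.
    by rewrite ffunE (negbTE ne); apply/eqP; rewrite (mov_supp M) eqxx orbT.
  have e7 : s' 7 (size st') = j'.
    by rewrite sst' //= rev_cons nth_rcons size_rev ltnn eqxx.
  have kW : size st' < W by apply: (small_lt D_ge HW); move: szk szp szi i_n;
    rewrite /=; clear; lia.
  have P1 : run W pop s' 40
    (fun s1 => [/\ s1 vK 0 = size st', s1 vC 0 = c & s1 vX 0 = x]).
    by apply: (run_pop ek' kW e7); rewrite fr.
  apply: run_le.
  - apply: run_seq; apply: run_impl (run_frame P1) (leqnn _) _ =>
      s1 [[k1 c1 x1] fr1].
    have r1 : rep s1 psi by apply: (rep_frame r') => l; rewrite fr1.
    have b1 : s1 vB 0 = b by rewrite fr1.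
    have q1 : s1 vQ 0 = 2 * D - 2 by rewrite fr1 // fr.
    apply: run_seq.
    apply: run_impl (run_frame (run_unassign D_ge HW r1 b1 x1 c1 q1 bx Epsi))
      (leqnn _) _.
    move=> s2 [r2 fr2].
    have n2 : s2 0 0 = n by rewrite fr2 // fr1 // fr.
    have a2 : s2 vA 0 = a by rewrite fr2 // fr1.
    have b2 : s2 vB 0 = b by rewrite fr2.
    have c2 : s2 vC 0 = c by rewrite fr2.
    have q2 : s2 vQ 0 = 2 * D - 2 by rewrite fr2.
    apply: run_seq.
    apply: run_impl (run_frame
      (run_assign D_ge HW r2 n2 a2 b2 c2 q2 ab Eab na nb)) (leqnn _) _.
    move=> s3 [r3 fr3].
    have b3 : s3 vB 0 = b by rewrite fr3.
    have x3 : s3 vX 0 = x by rewrite fr3 // fr2.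
    apply: run_impl (run_frame (run_advance b3 x3)) (leqnn _) _ =>
      s4 [[a4 b4] fr4].
    exists (shift1 psi [set a; b] [set b; x]), b, x, j', (rcons p [set b; x]),
      st'.
    split; last split.
    + split=> //; rewrite (shift1E _ Epsi).
      by apply: (rep_frame r3) => l; rewrite fr4.
    + split=> //; last by rewrite size_rcons -szp -szk /= addSnnS.
        move=> l lst'; rewrite fr4 // fr3 // fr2 // fr1 // sst' /=;
          last exact: ltnW.
        by rewrite rev_cons nth_rcons size_rev lst'.
      by rewrite fr4 // fr3 // fr2.
    + split; last by rewrite last_rcons.
        apply: shiftable_rcons; rewrite ?sh2 ?sh3 ?Epsi //.
          by rewrite /adjacent ne; apply/set0Pn; exists b;
            rewrite !inE eqxx orbT.
        exact: (mov_proper B M').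
      by rewrite shift_rcons sh2 sh3.
  - by [].
- by rewrite /=; move: (size st); clear; lia.
move=> s' [+ _ [k [psi
  [a [b [j [p [st'
  [[r' ea' eb' M [pst lst ast]] [[sst' ek' szk szp] [sh1 sh2 sh3]]]]]]]]]]].
rewrite [ev _ _]/= ek' => /size0nil st0; rewrite st0 /= in lst szk.
exists psi, a, b, p; split; first by split=> //; rewrite -{2}lst.
by split=> //; rewrite -szp -szk addn0.
Qed.

End Search.

(** * Insertions and deletions *)

Record good n D (G : graph n) (phi : pcoloring n (2 * D - 2)) (s : memory) :
  Prop :=
  Good {
  good_simple : simple G;
  good_maxdeg : maxdeg_le D G;
  good_rep : rep s phi;
  good_supp : forall f, (phi f == None) = (f \notin G) }.

(** Different seen colors lead to different neighbors. A blocked end sees [D - 1] colors, whence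
    [D <= n]. *)
Lemma card_sees_vertices n q (G : graph n) (psi : pcoloring n q) v : simple G ->
  (forall f, psi f <> None -> f \in G) -> #|[set c | sees psi v c]| < n.
Proof.
move=> sG supp.
have inj : injective (@Some 'I_q) by move=> x y [].
rewrite -(card_imset _ inj).
apply: (@leq_ltn_trans #|(fun w => psi [set v; w]) @: [set~ v]|).
  apply/subset_leq_card/subsetP => o /imsetP[c]; rewrite inE => /seesP[w E] ->.
  apply/imsetP; exists w; last by rewrite E.
  by rewrite !inE eq_sym; apply: simple_neq sG _; apply: supp; rewrite E.
apply: leq_ltn_trans (leq_imset_card _ _) _.
by rewrite cardsC1 card_ord ltn_predL (leq_ltn_trans _ (ltn_ord v)).
Qed.

Lemma run_set_palette n D W s p T P : 4 <= D -> large_words n D W ->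
  s 0 1 = D ->
  (forall s', (forall a j, a != vQ -> s' a j = s a j) -> s' vQ 0 = 2 * D - 2 ->
     run W p s' T P) ->
  run W (set_palette ;;; p) s (20 + T) P.
Proof.
move=> D_ge HW sD H; apply: run_seq; apply: run_le.
  apply: run_put.
  - by apply: (ok_lit D_ge HW).
  - have w2 : 2 < W by apply: (small_lt D_ge HW); lia.
    have h k : k <= 2 * D -> k < W by move=> kD; apply: (small_lt D_ge HW); lia.
    by rewrite /= sD; do !split=> //; apply: h; lia.
  - apply: H; first by move=> a j /negbTE na; rewrite /upd na.
    by rewrite /upd /= sD.
by [].
Qed.

Section Update.

Variables (n D W : nat) (G : graph n) (phi : pcoloring n (2 * D - 2))
  (u v : 'I_n).

Hypotheses (D_ge : 4 <= D) (HW : large_words n D W).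

Variables (s : memory).

Hypotheses (ok_s : good G phi s) (sn : s 0 0 = n) (sD : s 0 1 = D)
  (su : s 0 2 = u)
  (sv : s 0 3 = v).

Section Insertion.

Let e := [set u; v].
Let G' := e |: G.

Hypotheses (uv : u != v) (eG : e \notin G) (degG : maxdeg_le D G').

(** [D <= n] makes up for the exponent being one less than the length. The empty sequence gets no
    bound, since [D <= n] may then fail. *)
Definition short (p : seq {set 'I_n}) :=
  0 < size p -> D <= n /\ (D - 1) ^ (size p).-1 <= n.

Lemma card_sees_insert (psi : pcoloring n (2 * D - 2)) y :
  (forall f, psi f <> None -> f \in G') ->
  #|[set c : 'I_(2 * D - 2) | sees psi y c]| <= #|G'|.
Proof. by move=> supp; apply: leq_trans (card_sees _ supp) (degree_le _ _). Qed.

Record placed (s' : memory) (psi : pcoloring n (2 * D - 2)) (a b : 'I_n)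
    (c : 'I_(2 * D - 2)) (p : seq {set 'I_n}) : Prop := Placed {
  pl_rep : rep s' psi;
  pl_a : s' vA 0 = a;
  pl_b : s' vB 0 = b;
  pl_c : s' vC 0 = c;
  pl_free : ~~ sees psi a c && ~~ sees psi b c;
  pl_neq : a != b;
  pl_in : [set a; b] \in G';
  pl_supp : forall f, (psi f == None) = (f \notin G') || (f == [set a; b]);
  pl_shiftable : shiftable G' phi e p;
  pl_shift : shift phi e p = psi;
  pl_last : last e p = [set a; b];
  pl_short : short p }.

Lemma run_unblock s1 : (forall c, sees phi u c || sees phi v c) -> rep s1 phi ->
  s1 vA 0 = v -> s1 vB 0 = u -> s1 vQ 0 = 2 * D - 2 -> s1 0 0 = n ->
    s1 0 2 = u ->
  run W (grow ;;; trace ;;; move_along ;;; search) s1 (5000 * #|G'|)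
    (fun s' => exists psi a b c p, placed s' psi a b c p).
Proof.
move=> bl r1 a1 b1 q1 n1 u1.
have B : blocked_edge G phi u v.
  split=> //; [exact: good_simple ok_s | exact: good_supp ok_s | exact:
    rep_matching r1].
have cG' : #|G'| = #|G|.+1 by rewrite cardsU1 eG.
have Dn : D <= n.
  have := card_class B true.
  rewrite (_ : [set _ | _] = [set c | sees phi u c]); last first.
    by apply/setP => c; rewrite !inE eqb_id.
  have := @card_sees_vertices _ _ G phi u (good_simple ok_s).
  have supp f : phi f <> None -> f \in G by move/eqP;
    rewrite (good_supp ok_s) negbK.
  by move=> /(_ supp); card_lia.
have q0 : 0 < 2 * D - 2 by nat_lia.
(* The root has no parent: 0 and the first color merely fill the fields. *)
pose d := Node u true 0 (Ordinal q0).
apply: run_le.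
- apply: run_seq.
  apply: run_impl (run_frame
    (@run_grow _ _ _ _ _ _ _ B HW d erefl erefl _ r1 q1 u1)) (leqnn _) _.
  move=> s2 [[qs [i X]] fr2].
  have i_n := tree_index_le B (xd_tree X).
  have iG : i <= 2 * #|G|.
    by apply: leq_trans (tree_edges B (xd_tree X)); rewrite leq_pmulr //;
      nat_lia.
  apply: run_seq.
  have le3 : 100 * i.+1 <= 100 * (2 * #|G|).+1
    by rewrite leq_mul2l ltnS iG orbT.
  apply: run_impl (run_frame (run_trace B HW X)) le3 _.
  move=> s3 [[st [br sst ek szi pw]] fr3].
  have X3 : explored phi u d s3 qs i.
    split; [exact: xd_tree X | exact: xd_open X | |
      by rewrite fr3 // (xd_index X)].
    by move=> j jq; rewrite !fr3 //; apply: (xd_queue X).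
  have r3 : rep s3 phi by apply: (rep_frame r1) => j; rewrite fr3 // fr2.
  have a3 : s3 vA 0 = v by rewrite fr3 // fr2.
  have b3 : s3 vB 0 = u by rewrite fr3 // fr2.
  have q3 : s3 vQ 0 = 2 * D - 2 by rewrite fr3 // fr2.
  have n3 : s3 0 0 = n by rewrite fr3 // fr2.
  apply: run_seq.
  have le4 : 300 * (size st).+1 <= 300 * (2 * #|G|).+1.
    by rewrite leq_mul2l ltnS (leq_trans szi iG) orbT.
  apply: run_impl (run_frame
    (run_move_along B HW X3 r3 a3 b3 q3 n3 br sst ek szi)) le4 _.
  move=> s4 [[psi [a [b [p [[r4 a4 b4 M] [sh1 sh2 sh3 szp]]]]]] fr4].
  have q4 : s4 vQ 0 = 2 * D - 2 by rewrite fr4.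
  have supp f : psi f <> None -> f \in G'.
    by move/eqP; rewrite (mov_supp M) negb_or negbK => /andP[].
  have cK : #|[set c | sees psi a c]| + #|[set c | sees psi b c]| <= 2 * #|G'|.
    by rewrite (mul2n #|G'|) -addnn leq_add // card_sees_insert.
  apply: run_impl (run_frame (run_search D_ge HW r4 a4 b4 q4 cK)) (leqnn _) _.
  move=> s5 [[c [c5 cq seen free]] fr5].
  have [c0 c0free] := moving_end B (xd_tree X) M (xd_open X).
  have {}cq : c < 2 * D - 2.
    rewrite ltn_neqAle cq andbT; apply/eqP => cE.
    have := seen c0; rewrite cE ltn_ord => /(_ isT).
    by case/andP: c0free => /negbTE -> /negbTE ->.
  exists psi, a, b, (Ordinal cq), p; split=> //.
  + by apply: (rep_frame r4) => j; rewrite fr5.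
  + by rewrite fr5.
  + by rewrite fr5.
  + exact: free.
  + exact: (mov_neq B (xd_tree X) M).
  + exact: (mov_ab B (xd_tree X) M).
  + exact: mov_supp M.
  + rewrite /short szp => st0; split=> //; exact: leq_trans (pw st0) i_n.
- by rewrite cG'; move: #|G| => m; clear; lia.
Qed.

Lemma run_insertion :
  run W insertion s (100 * 100 * #|G'|) (fun s' => exists psi c p,
  [/\ good G' (set_color psi (last e p) c) s', shiftable G' phi e p,
      shift phi e p = psi & short p]).
Proof.
have sG := good_simple ok_s.
have w1 := one_lt D_ge HW; have w0 : 0 < W := ltnW w1.
have w3 : 3 < W by apply: (small_lt D_ge HW); nat_lia.
have w2 : 2 < W := ltnW w3.
have cG' : #|G'| = #|G|.+1 by rewrite cardsU1 eG.
have sG' : simple G' by move=> f /setU1P[->|/sG //]; rewrite cards2 uv.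
have supp f : phi f <> None -> f \in G'.
  by move/eqP; rewrite (good_supp ok_s) negbK => fG; rewrite in_setU1 fG orbT.
have phie : phi e = None by apply/eqP; rewrite (good_supp ok_s).
have cK : #|[set c | sees phi v c]| + #|[set c | sees phi u c]| <= 2 * #|G'|.
  by rewrite (mul2n #|G'|) -addnn leq_add // card_sees_insert.
apply: run_le.
- apply: run_seq; apply: (run_set_palette D_ge HW sD) => s1 fr1 q1.
  apply: run_seq; apply: run_put => //; apply: run_put => //.
  rewrite [ev _ (Lit 0)]/=; set s2 := upd _ _ _ _.
  have a2 : s2 vA 0 = v by rewrite /s2 /upd /= fr1.
  have b2 : s2 vB 0 = u by rewrite /s2 /upd /= fr1.
  have q2 : s2 vQ 0 = 2 * D - 2 by rewrite /s2 /upd /=.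
  have n2 : s2 0 0 = n by rewrite /s2 /upd /= fr1.
  have u2 : s2 0 2 = u by rewrite /s2 /upd /= fr1.
  have r2 : rep s2 phi by apply: (rep_frame (good_rep ok_s)) => j;
    rewrite /s2 /upd /= fr1.
  move: s2 a2 b2 q2 n2 u2 r2 => s2 a2 b2 q2 n2 u2 r2.
  apply: run_seq.
  apply: run_impl (run_frame (run_search D_ge HW r2 a2 b2 q2 cK)) (leqnn _) _.
  move=> s3 [[c [c3 cq seen free]] fr3].
  have r3 : rep s3 phi by apply: (rep_frame r2) => j; rewrite fr3.
  have H : run W (If (var vC =e var vQ) (grow ;;; trace ;;; move_along ;;;
    search) Skip) s3
      (20 + 5000 * #|G'|) (fun s' => exists psi a b c p, placed s' psi a b c p).
    apply: run_le.
    + apply: (@run_if _ _ _ _ _ (5000 * #|G'|)).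
      * by apply: (ok_eq D_ge HW); apply: (ok_var D_ge HW).
      * rewrite [ev _ _]/= c3 fr3 // q2 eqb0 negbK => /eqP cE.
        apply: run_unblock => //; rewrite ?fr3 //.
        by move=> c'; rewrite orbC; apply: seen; rewrite cE.
      * rewrite [ev _ _]/= c3 fr3 // q2 => /eqP; rewrite eqb0 => cE.
        have {}cq : c < 2 * D - 2 by rewrite ltn_neqAle cE.
        apply: run_le; first apply: run_skip.
          exists phi, v, u, (Ordinal cq), [::]; split=> //; rewrite ?fr3 //.
          - exact: free.
          - by rewrite eq_sym.
          - by rewrite setUC setU11.
          - move=> f; rewrite (good_supp ok_s) setUC in_setU1 negb_or -/e.
            by case: (f =P e) => [->|_]; rewrite ?orbF ?eG.
          - by rewrite /= setUC.
        by rewrite cG'; move: #|G| => m; lia.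
    + by rewrite /=; lia.
  apply: run_seq; apply: run_impl (run_frame H) (leqnn _) _.
  move=> s4 [[psi [a [b [c' [p P]]]]] fr4].
  have [na nb] := andP (pl_free P).
  have q4 : s4 vQ 0 = 2 * D - 2 by rewrite fr4 // fr3.
  have n4 : s4 0 0 = n by rewrite fr4 // fr3.
  have Eab : psi [set a; b] = None.
    by apply/eqP; rewrite (pl_supp P) eqxx orbT.
  apply: run_impl (run_assign D_ge HW (pl_rep P) n4 (pl_a P) (pl_b P) (pl_c P)
    q4 (pl_neq P) Eab na nb) (leqnn _) _.
  move=> s5 r5; exists psi, c', p.
  split; [|exact: pl_shiftable P|exact: pl_shift P|exact: pl_short P].
  rewrite (pl_last P); split=> // f; rewrite ffunE.
  case: (f =P [set a; b]) => [->|fab]; first by rewrite (pl_in P).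
  by rewrite (pl_supp P); case: eqP fab; rewrite ?orbF.
- by rewrite cG' /=; move: #|G| => m; clear; lia.
Qed.

End Insertion.
End Update.

Lemma run_deletion n D W (G : graph n) phi (u v : 'I_n) s :
  4 <= D -> large_words n D W -> good (D := D) G phi s -> s 0 0 = n ->
    s 0 1 = D ->
  s 0 2 = u -> s 0 3 = v -> [set u; v] \in G ->
  run W deletion s 200
    (fun s' => good (G :\ [set u; v]) (uncolor phi [set u; v]) s').
Proof.
move=> D_ge HW gs sn sD su sv eG.
have un := ltn_ord u; have vn := ltn_ord v.
have w1 := one_lt D_ge HW; have w0 : 0 < W := ltnW w1.
have w3 : 3 < W by apply: (small_lt D_ge HW); lia.
have w2 : 2 < W := ltnW w3.
have uv : u != v := simple_neq (good_simple gs) eG.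
case E : (phi [set u; v]) => [c|]; last first.
  by have := good_supp gs [set u; v]; rewrite E eG.
have cn := ltn_ord c.
have sc := rep_out (good_rep gs) E.
apply: run_le.
- apply: run_seq; apply: (run_set_palette D_ge HW sD) => s1 fr1 q1.
  do 2 (apply: run_seq; apply: run_put => //).
  apply: run_put => //.
    apply: (ok_sub D_ge HW) => //=; rewrite /upd /= !fr1 // su sv sn.
      do !split=> //; last by apply: (pair_lt D_ge HW); lia.
      by rewrite -[_ * _]addn0; apply: (pair_lt D_ge HW); lia.
    by rewrite sc; lia.
  set s2 := upd _ _ _ _.
  have b2 : s2 vB 0 = u by rewrite /s2 /upd /= fr1.
  have x2 : s2 vX 0 = v by rewrite /s2 /upd /= fr1.
  have c2 : s2 vC 0 = c by rewrite /s2 /upd /= !fr1 // su sv sn sc subn1.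
  have q2 : s2 vQ 0 = 2 * D - 2 by rewrite /s2 /upd /=.
  have r2 : rep s2 phi by apply: (rep_frame (good_rep gs)) => j;
    rewrite /s2 /upd /= fr1.
  apply: run_impl (run_unassign D_ge HW r2 b2 x2 c2 q2 uv E) (leqnn _) _ =>
    s3 r3.
  split=> //.
  + by move=> f /setD1P[_ /(good_simple gs)].
  + move=> y; apply: leq_trans (good_maxdeg gs y);
      apply/subset_leq_card/subsetP => f.
    by rewrite !inE => /andP[/andP[_ ->] ->].
  + move=> f; rewrite ffunE !inE; case: (f =P _) => [//|_] /=;
      exact: good_supp gs f.
- by [].
Qed.

(** * The invariant along reachable configurations *)

Lemma good_stores n D (G : graph n) phi s : good (D := D) G phi s ->
  stores s G phi /\ proper_coloring G phi.
Proof.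
move=> g; have supp := good_supp g; split.
  split=> [u v|f fG]; last by apply/eqP; rewrite supp.
  case E : (phi [set u; v]) => [c|]; first by rewrite (rep_out (good_rep g) E).
  by have := supp [set u; v]; rewrite E => /esym/negbTE ->.
split; last by move=> f fG /eqP; rewrite supp fG.
apply: matching_proper (good_simple g) _ (rep_matching (good_rep g)).
by move=> f fG; apply/eqP; rewrite supp.
Qed.

Lemma color_code_inj q : injective (@color_code q).
Proof. by move=> [x|] [y|] //= [/val_inj ->]. Qed.

Lemma stores_inj n q s (G : graph n) (phi psi : pcoloring n q) : simple G ->
  stores s G phi -> stores s G psi -> phi = psi.
Proof.
move=> sG [c1 z1] [c2 z2]; apply/ffunP => f.
case: (boolP (f \in G)) => fG; last by rewrite z1 // z2.
have [v vf] : exists v, v \in f by apply/card_gt0P; rewrite sG.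
have [w E _] := simple_pair sG fG vf; rewrite E in fG *.
by apply: color_code_inj; rewrite -c1 // -c2.
Qed.

(** The exponent 5 is 3 + 2: [(n + D) ^ 3 >= 64] exceeds the factor 36, and the square remains. *)
Lemma power_large n D : 4 <= D -> large_words n D ((n + D) ^ 5).
Proof.
move=> D_ge; rewrite /large_words (expnD _ 3 2) leq_mul // -?expnS ?mulnn //.
apply: (@leq_trans (4 ^ 3)) => //.
by rewrite leq_exp2r // (leq_trans D_ge) // leq_addl.
Qed.

Lemma update_step D n (G : graph n) phi s up : 4 <= D -> good G phi s ->
  valid_update D G up ->
  exists t s' (phi' : pcoloring n (2 * D - 2)),
    [/\ exec ((n + D) ^ 5) (program_for insertion deletion up) (load D up s) t
      s',
        good (apply_update G up) phi' s', t <= 100 * 100 * #|edge up |: G|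
      & match up with
        | Insert _ _ => exists p c,
          [/\ shiftable (apply_update G up) phi (edge up) p,
            phi' = set_color (shift phi (edge up) p) (last (edge up) p) c &
              short D p]
        | Delete _ _ => recourse (apply_update G up) phi phi' = 0
        end].
Proof.
move=> D_ge gs; have HW := power_large n D_ge.
have gl : good G phi (load D up s).
  case: gs => h1 h2 h3 h4; split=> //; apply: (rep_frame h3) => j;
  by rewrite /load /upd; case: up.
case: up gl => u v gl /=.
  move=> [uv eG degG].
  have [t [s' [ex le [psi [c [p [g sh1 sh2 sh3]]]]]]] :=
    run_insertion D_ge HW gl erefl erefl erefl erefl uv eG degG.
  exists t, s', (set_color psi (last [set u; v] p) c); split=> //.
  by exists p, c; rewrite sh2.
move=> eG.
have [t [s' [ex le g]]] := run_deletion D_ge HW gl erefl erefl erefl erefl eG.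
exists t, s', (uncolor phi [set u; v]); split=> //.
  apply: leq_trans le _; rewrite cardsU1 eG add0n (cardD1 [set u; v]) eG.
  by rewrite mulnDr muln1; apply: leq_trans (leq_addr _ _).
apply/eqP; rewrite cards_eq0; apply/eqP/setP => f; rewrite !inE ffunE.
by case: (f =P _) => //= _; rewrite eqxx !andbF.
Qed.

(** [reachable] admits any halting run and any coloring stored by it; [exec_det] and [stores_inj]
    identify these with the run and the coloring of [update_step]. *)
Lemma reachable_good D n (G : graph n) phi s : 4 <= D ->
  reachable ((n + D) ^ 5) insertion deletion D G phi s -> good (D := D) G phi s.
Proof.
move=> D_ge; elim=> {G phi s} [|G phi s up t s' phi' _ g val ex st].
  split=> [f|y||f]; rewrite ?inE //.
  - by rewrite /degree (_ : [set _ in _ | _] = set0) ?cards0 //;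
      apply/setP => f; rewrite !inE.
  - by split=> [v w c|//|u v c]; rewrite ffunE.
  - by rewrite ffunE.
have [t2 [s2 [phi2 [ex2 g2 _ _]]]] := update_step D_ge g val.
have [_ sE] := exec_det ex ex2; subst s2.
by rewrite (stores_inj (good_simple g2) st (good_stores g2).1).
Qed.

(** * The lower bound *)

(* The [i]-th branch edge joins the vertex [i %/ b] to [child i]; its color is
   the [i %% b]-th one of the class of type [T (i %/ b)]. *)
Section Layered.

Variables (n b N : nat) (child : nat -> nat) (T : nat -> bool) (v0 : 'I_n).

Record layering : Prop := Layering {
  ly_width : 0 < b;
  ly_order : 1 < n;
  ly_bound : forall i, i < N -> maxn 1 (i %/ b) < child i < n;
  ly_root : T 0 = false /\ T 1 = true;
  ly_color_inj : forall i j, i < N -> j < N -> child i = child j ->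
    T (i %/ b) * b + i %% b = T (j %/ b) * b + j %% b -> i = j;
  ly_edge_inj : forall i j, i < N -> j < N -> child i = child j ->
    i %/ b = j %/ b -> i = j;
  ly_type : forall i j, i < N -> j < N -> child i = j %/ b ->
    T (i %/ b) <> T (j %/ b);
  ly_degree : forall y, y < n ->
    (y < 2) + #|[set i : 'I_N | i %/ b == y]| + #|[set i : 'I_N | child i == y]|
      <= b.+1 }.

Definition vx k : 'I_n := insubd v0 k.

Definition branch_edge i := [set vx (i %/ b); vx (child i)].
Definition root_edge := [set vx 0; vx 1].
Definition layered : graph n := root_edge |: [set branch_edge i | i : 'I_N].

Definition layer_color i : option 'I_(2 * b) := insub (T (i %/ b) * b + i %% b).
Definition layer_coloring : pcoloring n (2 * b) :=
  [ffun f => if [pick i : 'I_N | branch_edge i == f] is Some i then layer_color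
    i else None].

Definition upper_half (c : 'I_(2 * b)) := b <= c.

Hypothesis L : layering.

Let b_gt0 := ly_width L.
Let n_ge := ly_order L.
Let child_bound := ly_bound L.
Let T01 := ly_root L.
Let child_inj := ly_color_inj L.
Let child_edge_inj := ly_edge_inj L.
Let child_type := ly_type L.
Let child_degree := ly_degree L.

Lemma vxE k : k < n -> vx k = k :> nat.
Proof. by move=> kn; rewrite /vx val_insubd kn. Qed.

Lemma vx_inj j k : j < n -> k < n -> vx j = vx k -> j = k.
Proof. by move=> jn kn /(congr1 val) /=; rewrite !vxE. Qed.

Lemma par_bound i : i < N -> i %/ b < n.
Proof. by move=> /child_bound; lia. Qed.

Lemma child_lt i : i < N -> child i < n. Proof. by move=> /child_bound; lia.
  Qed.

(** A parent has a smaller number than its child, so that an edge determines its orientation. *)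
Lemma branch_edge_inj i j : i < N -> j < N -> branch_edge i = branch_edge j ->
  i = j.
Proof.
move=> iN jN /set2_eqP[] [p c].
  apply: child_edge_inj => //;
    first exact: vx_inj (child_lt iN) (child_lt jN) c.
  exact: vx_inj (par_bound iN) (par_bound jN) p.
have := vx_inj (par_bound iN) (child_lt jN) p.
have := vx_inj (child_lt iN) (par_bound jN) c.
by have := child_bound iN; have := child_bound jN; lia.
Qed.

Lemma branch_root i : i < N -> branch_edge i <> root_edge.
Proof.
move=> iN /set2_eqP[] [_ c]; have := child_bound iN.
  by rewrite (vx_inj (child_lt iN) _ c) //; lia.
by rewrite (vx_inj (child_lt iN) _ c) //; lia.
Qed.

Lemma layered_simple : simple layered.
Proof.
move=> f /setU1P[->|/imsetP[i _ ->]].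
  by rewrite cards2; case: eqP => // /vx_inj; lia.
rewrite cards2; case: eqP =>
  // /(vx_inj (par_bound (ltn_ord i)) (child_lt (ltn_ord i))).
by have := child_bound (ltn_ord i); lia.
Qed.

Lemma layer_color_lt i : T (i %/ b) * b + i %% b < 2 * b.
Proof. by have := ltn_pmod i b_gt0; case: (T _); lia. Qed.

Lemma layer_coloringE i : i < N ->
  layer_coloring (branch_edge i) = layer_color i.
Proof.
move=> iN; rewrite ffunE;
  case: pickP => [j /eqP /branch_edge_inj E|/(_ (Ordinal iN))].
  by rewrite E.
by rewrite eqxx.
Qed.

Lemma layer_colorE i : exists2 c,
  layer_color i = Some c & upper_half c = T (i %/ b).
Proof.
rewrite /layer_color insubT ?layer_color_lt // => lt.
exists (Sub (T (i %/ b) * b + i %% b) lt) => //.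
rewrite /upper_half SubK; have := ltn_pmod i b_gt0.
by case: (T _); lia.
Qed.

Lemma layer_coloring_root : layer_coloring root_edge = None.
Proof. by rewrite ffunE; case: pickP => // i /eqP /branch_root; case. Qed.

Lemma layer_coloring_None f : f \in layered ->
  (layer_coloring f = None <-> f = root_edge).
Proof.
move=> /setU1P[->|/imsetP[i _ ->]]; first by rewrite layer_coloring_root.
rewrite layer_coloringE //; have [c -> _] := layer_colorE i.
by split=> // /branch_root; case.
Qed.

Lemma layer_coloring_Some f c : layer_coloring f = Some c -> exists2 i, i < N &
  f = branch_edge i /\ T (i %/ b) * b + i %% b = c.
Proof.
rewrite ffunE; case: pickP => // i /eqP <- E; exists i => //; split=> //.
move: E; rewrite /layer_color; case: insubP => // x _ <- [->] //.
Qed.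

(** Two edges below [v] with one color have the same quotient and remainder by [b]; an edge above
    and one below differ in type; two edges above are the case of [ly_color_inj]. *)
Lemma layer_matching : matching layer_coloring.
Proof.
move=> v w w' c /layer_coloring_Some[i iN [Ei ci]]
  /layer_coloring_Some[j jN [Ej cj]].
suff ij : i = j by apply: (@set2_inj _ v); rewrite Ei Ej ij.
rewrite -cj in ci.
have TE : T (i %/ b) = T (j %/ b).
  have := ltn_pmod i b_gt0; have := ltn_pmod j b_gt0.
  by move: ci; case: (T _); case: (T _) => //; lia.
have mE : i %% b = j %% b by move: ci; rewrite TE => /addnI.
case/esym/set2_eqP: Ei => -[pi ci']; case/esym/set2_eqP: Ej => -[pj cj'].
- have pE : i %/ b = j %/ b by apply: vx_inj; rewrite ?par_bound // pi pj.
  by rewrite (divn_eq i b) pE mE -divn_eq.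
- have pE : child j = i %/ b by apply: vx_inj;
    rewrite ?par_bound ?child_lt // pi cj'.
  by case: (child_type jN iN pE).
- have pE : child i = j %/ b by apply: vx_inj;
    rewrite ?par_bound ?child_lt // pj ci'.
  by case: (child_type iN jN pE).
- apply: child_inj => //; apply: vx_inj; rewrite ?child_lt // ci' cj' //.
Qed.

Lemma layered_proper : proper_partial layered layer_coloring.
Proof.
apply: matching_proper layered_simple _ layer_matching => f fG.
case E : (layer_coloring f) => [c|//];
  have [i iN [fE _]] := layer_coloring_Some E.
by case/negP: fG; rewrite fE; apply/setU1P; right; apply/imsetP;
  exists (Ordinal iN).
Qed.

Lemma layered_degree y : degree layered y <= b.+1.
Proof.
apply: leq_trans (child_degree (ltn_ord y)).
pose A := [set branch_edge (nat_of_ord i) | i in [set i : 'I_N | i %/ b == y]].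
pose B := [set branch_edge (nat_of_ord i) | i in [set i : 'I_N | child i == y]].
pose R := if y < 2 then [set root_edge] else set0.
apply: (@leq_trans #|R :|: A :|: B|).
  apply/subset_leq_card/subsetP => f;
    rewrite inE => /andP[/setU1P[->|/imsetP[i _ ->]]].
    rewrite !inE => yr; have y2 : y < 2.
      by case/orP: yr => /eqP ->; rewrite vxE //; lia.
    by rewrite /R y2 inE eqxx.
  rewrite !in_set2 => /orP[]/eqP yE; apply/setUP;
    [left; apply/setUP; right|right];
    apply/imsetP; exists i => //; rewrite inE yE vxE ?par_bound ?child_lt //.
apply: leq_trans (leq_card_setU _ _) _; apply: leq_add;
  last exact: leq_imset_card.
apply: leq_trans (leq_card_setU _ _) _; apply: leq_add;
  last exact: leq_imset_card.
by rewrite /R; case: ifP; rewrite ?cards1 ?cards0.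
Qed.

Lemma card_half t : #|[set c | upper_half c == t]| = b.
Proof.
have h : #|[set c : 'I_(2 * b) | c < b]| = b by apply: card_below; lia.
have := cardsC [set c : 'I_(2 * b) | c < b]; rewrite card_ord h => hc.
case: t; last by rewrite -[RHS]h; apply: eq_card => c;
  rewrite !inE /upper_half ltnNge eqbF_neg.
suff -> : [set c | upper_half c == true] = ~: [set c : 'I_(2 * b) | c < b]
  by card_lia.
by apply/setP => c; rewrite !inE /upper_half -leqNgt eqb_id.
Qed.

(* Pigeonhole: an edge at [y] whose color is of the type of the [b] branch edges
   below [y] forces one of these out of its type. *)
Lemma pushed_down (psi : pcoloring n (2 * b)) y f0 c0 :
  proper_coloring layered psi ->
  y.+1 * b <= N -> f0 \in layered -> vx y \in f0 ->
  (forall i, i < N -> i %/ b = y -> branch_edge i <> f0) ->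
  psi f0 = Some c0 -> upper_half c0 = T y ->
  exists i c, [/\ i < N, i %/ b = y,
    psi (branch_edge i) = Some c & upper_half c = ~~ T y].
Proof.
move=> [[_ pr] tot] yN f0G yf0 nf0 E0 h0.
pose idx (r : 'I_b) := y * b + r.
have idxN r : idx r < N by rewrite /idx; have := ltn_ord r; nia.
have idxy r : idx r %/ b = y by rewrite /idx divnMDl // divn_small ?addn0.
have inG r : branch_edge (idx r) \in layered.
  by apply/setU1P; right; apply/imsetP; exists (Ordinal (idxN r)).
have yin r : vx y \in branch_edge (idx r) by rewrite !inE idxy eqxx.
(* [psi] colors every edge of the graph, so that the default [c0] is never taken. *)
pose col (r : 'I_b) := odflt c0 (psi (branch_edge (idx r))).
have colE r : psi (branch_edge (idx r)) = Some (col r).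
  by rewrite /col; have := tot _ (inG r); case: (psi _).
case: (pickP (fun r => upper_half (col r) != T y)) => [r hr|all_same].
  exists (idx r), (col r); split=> //; by case: (upper_half _) hr; case: (T y).
(* [None] stands for [f0]: these are [b + 1] edges at one vertex, against [b] colors of one type. *)
pose g (o : option 'I_b) := if o is Some r then col r else c0.
have adj (e f : {set 'I_n}) : vx y \in e -> vx y \in f -> e <> f ->
  adjacent e f.
  by move=> ye yf ef; apply/andP; split;
    [apply/eqP | apply/set0Pn; exists (vx y); rewrite inE ye yf].
have g_inj : injective g.
  have H r : col r <> c0.
    move=> cE; apply: (pr _ _ (inG r) f0G); rewrite ?colE //;
      last by rewrite E0 cE.
    by apply: adj => //; apply: nf0.
  move=> [r|] [r'|] //=; [|by move/H|by move/esym/H].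
  case: (r =P r') => [->//|ne] cE.
  case: (pr _ _ (inG r) (inG r')); rewrite ?colE ?cE //.
  apply: adj => // /branch_edge_inj E; apply: ne; apply: val_inj.
  by have /addnI := E (idxN r) (idxN r').
have : #|g @: [set: option 'I_b]| <= #|[set c | upper_half c == T y]|.
  apply/subset_leq_card/subsetP => c /imsetP[[r|] _ ->]; rewrite inE /= ?h0 //.
  by have := all_same r => /negbFE.
by rewrite card_imset // cardsT card_option card_ord card_half ltnn.
Qed.

Lemma changed_recourse (psi : pcoloring n (2 * b)) (s : seq nat) : uniq s ->
  (forall i, i \in s -> i < N /\
    psi (branch_edge i) <> layer_coloring (branch_edge i)) ->
  size s <= recourse layered layer_coloring psi.
Proof.
move=> us H; have um : uniq (map branch_edge s).
  rewrite map_inj_in_uniq // => i j /H[iN _] /H[jN _]; exact: branch_edge_inj.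
rewrite -(size_map branch_edge) -(card_uniqP um);
  apply/subset_leq_card/subsetP => f.
move=> /mapP[i /H[iN /eqP ne] ->]; rewrite !inE ne andbT.
rewrite layer_coloringE //; have [c -> _] := layer_colorE i; rewrite andbT.
by apply/orP; right; apply/imsetP; exists (Ordinal iN).
Qed.

Lemma changed_type (psi : pcoloring n (2 * b)) i c : i < N ->
  psi (branch_edge i) = Some c -> upper_half c = ~~ T (i %/ b) ->
  psi (branch_edge i) <> layer_coloring (branch_edge i).
Proof.
move=> iN -> h; rewrite layer_coloringE //; have [c' -> h'] := layer_colorE i.
by move=> [cE]; move: h; rewrite cE h'; case: (T _).
Qed.

(** The ends of the root edge have different types, so that any color given to it is of the type of
    one of them. *)
Lemma root_pushes (psi : pcoloring n (2 * b)) : proper_coloring layered psi ->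
  2 * b <= N ->
  exists i c, [/\ i < N, i %/ b < 2,
    psi (branch_edge i) = Some c & upper_half c = ~~ T (i %/ b)].
Proof.
move=> pc bN; have rG : root_edge \in layered by rewrite setU11.
case E : (psi root_edge) => [c|]; last by case: (pc.2 _ rG).
have [y y2 hy] : exists2 y, y < 2 & upper_half c = T y.
  by case: (upper_half c); [exists 1 | exists 0]; rewrite ?T01.1 ?T01.2.
have yr : vx y \in root_edge by case: y y2 {hy} => [|[|]] //;
  rewrite !inE eqxx ?orbT.
have yN : y.+1 * b <= N by apply: leq_trans bN; rewrite leq_mul2r y2 orbT.
have nr i : i < N -> i %/ b = y -> branch_edge i <> root_edge by move=> iN _;
  apply: branch_root.
have [i [c' [iN iy Ei hi]]] := pushed_down pc yN rG yr nr E hy.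
by exists i, c'; rewrite iy.
Qed.

End Layered.

(** * Graphs that force recolorings *)

Definition forces n q (D k : nat) :=
  exists (G : graph n) (e : {set 'I_n}) (phi : pcoloring n q),
    [/\ simple G, maxdeg_le D G, proper_partial G phi,
        (forall f, f \in G -> (phi f = None <-> f = e)) /\ e \in G
      & forall psi : pcoloring n q, proper_coloring G psi ->
        k <= recourse G phi psi].

Lemma divn_lt2 b i : 0 < b -> i < 2 * b -> i %/ b = (b <= i).
Proof.
move=> b0 i2; case: leqP => bi; last by rewrite divn_small.
by apply/eqP; rewrite eqn_leq -ltnS ltn_divLR // i2 leq_divRL // mul1n.
Qed.

Lemma card_ord_pair N (P : nat -> bool) b : 0 < b ->
  {in P &, forall i j, i %% b = j %% b -> i = j} ->
    #|[set i : 'I_N | P i]| <= b.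
Proof.
move=> b0 inj.
have inj' : {in [set i : 'I_N | P i] &,
  injective (fun i : 'I_N => Ordinal (ltn_pmod i b0))}.
  by move=> i j; rewrite !inE =>
    Pi Pj /(congr1 val) /= /(inj _ _ Pi Pj) /val_inj.
by rewrite -(card_in_imset inj') -[leqRHS]card_ord max_card.
Qed.

(* When [n] is too small for a tree, both ends of the root edge get the same [b]
   children. *)
Lemma forces_one n b : 2 <= b -> b + 2 <= n -> forces n (2 * b) b.+1 1.
Proof.
move=> b2 bn; have b0 : 0 < b by lia.
have n1 : 1 < n by lia.
have n0 : 0 < n by lia.
pose child i := i %% b + 2.
pose T y := y == 1.
pose v0 : 'I_n := Ordinal n0.
have cb i : i < 2 * b -> maxn 1 (i %/ b) < child i < n.
  move=> i2; rewrite (divn_lt2 b0 i2) /child; have := ltn_pmod i b0.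
  by case: (b <= i); lia.
have T01 : T 0 = false /\ T 1 = true by [].
have TE i : i < 2 * b -> T (i %/ b) = i %/ b :> nat.
  by move=> i2; rewrite (divn_lt2 b0 i2); case: (b <= i).
have cei i j : i < 2 * b -> j < 2 * b -> child i = child j -> i %/ b = j %/ b ->
  i = j.
  by move=> _ _ /addIn m d; rewrite (divn_eq i b) m d -divn_eq.
have ci i j : i < 2 * b -> j < 2 * b -> child i = child j ->
    T (i %/ b) * b + i %% b = T (j %/ b) * b + j %% b -> i = j.
  move=> i2 j2 m; rewrite !TE // -!divn_eq //.
have ct i j : i < 2 * b -> j < 2 * b -> child i = j %/ b ->
  T (i %/ b) <> T (j %/ b).
  by move=> _ j2; rewrite /child (divn_lt2 b0 j2); case: (b <= j); lia.
have cd y : y < n ->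
  (y < 2) + #|[set i : 'I_(2 * b) | i %/ b == y]| +
    #|[set i : 'I_(2 * b) | child i == y]| <= b.+1.
  move=> yn; case: (ltnP y 2) => y2.
    rewrite (_ : [set i : 'I__ | child i == y] = set0) ?cards0 ?addn0 ?add1n
      ?ltnS.
      apply: (@card_ord_pair _ (fun i => i %/ b == y)) =>
        // i j /eqP iy /eqP jy m.
      by rewrite (divn_eq i b) m iy -jy -divn_eq.
    by apply/setP => i; rewrite !inE /child; lia.
  rewrite (_ : [set i : 'I__ | i %/ b == y] = set0) ?cards0 ?add0n.
    apply: (@leq_trans 2); last by lia.
    have inj : {in [set i : 'I_(2 * b) | child i == y] &,
      injective (fun i : 'I_(2 * b) => b <= i)}.
      move=> i j; rewrite !inE => /eqP iy /eqP jy h;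
        apply/val_inj/(cei _ _ (ltn_ord i) (ltn_ord j));
        first exact: etrans iy (esym jy).
      by rewrite (divn_lt2 b0 (ltn_ord i)) (divn_lt2 b0 (ltn_ord j)) h.
    by rewrite -(card_in_imset inj) -card_bool max_card.
  by apply/setP => i; rewrite !inE divn_lt2 //; case: (b <= i); lia.
have L : layering n b (2 * b) child T by split.
exists (layered b (2 * b) child v0), (root_edge v0),
  (layer_coloring b (2 * b) child T v0); split.
- exact: (layered_simple L).
- by move=> y; apply: (layered_degree v0 L).
- exact: (layered_proper v0 L).
- by split; [move=> f; apply: (layer_coloring_None L) | rewrite setU11].
- move=> psi pc.
  have [i [c [iN _ Ei hi]]] := root_pushes L pc (leqnn _).
  apply: (@changed_recourse _ _ _ _ _ _ L psi [:: i]) => // j.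
  by rewrite inE => /eqP ->; split=> //; apply: (changed_type L iN Ei hi).
Qed.

(** The type of [y] in a heap with the two roots 0 and 1, where [y >= 2] has parent [(y - 2) %/ b].
    The recursion is not structural; any fuel above [y] gives the same value. *)
Fixpoint parity b fuel y : bool :=
  if fuel is fuel'.+1 then
    if y < 2 then y == 1 else ~~ parity b fuel' ((y - 2) %/ b)
  else false.

Lemma parity_fuel b k l y : y < k -> y < l -> parity b k y = parity b l y.
Proof.
elim: k l y => [//|k IH] [//|l] y yk yl /=; case: ltnP => // y2.
by congr (~~ _); apply: IH; have := leq_div (y - 2) b; lia.
Qed.

Lemma parity_child b i : 0 < b ->
  parity b i.+3 (i + 2) = ~~ parity b (i %/ b).+1 (i %/ b).
Proof.
move=> b0; have -> : parity b i.+3 (i + 2) =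
    if i + 2 < 2 then i + 2 == 1 else ~~ parity b i.+2 ((i + 2 - 2) %/ b) by [].
rewrite ifF; last by lia.
by rewrite addnK; congr (~~ _); apply: parity_fuel; have := leq_div i b; lia.
Qed.

(** The heap uses all [n] vertices, each edge [i] having the lower end [i + 2]. A changed edge
    forces a changed edge one level below as long as that level is complete under it, and the
    indices increase along this chain. *)
Lemma forces_log n b k : 2 <= b -> 3 * b.+1 ^ k <= n -> 0 < k ->
  forces n (2 * b) b.+1 k.
Proof.
move=> b2 kn k0; have b0 : 0 < b by lia.
have Dn : 3 * b.+1 <= n.
  by apply: leq_trans kn; rewrite leq_mul2l -[X in X <= _]expn1 leq_pexp2l.
have n1 : 1 < n by lia.
have n0 : 0 < n by lia.
pose child i := i + 2.
pose T y := parity b y.+1 y.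
pose N := n - 2.
pose v0 : 'I_n := Ordinal n0.
have cb i : i < N -> maxn 1 (i %/ b) < child i < n.
  by have := leq_div i b; rewrite /child /N; lia.
have T01 : T 0 = false /\ T 1 = true by [].
have Tc i : T (child i) = ~~ T (i %/ b).
  by rewrite /T /child -parity_child // addn2.
have cei i j : i < N -> j < N -> child i = child j -> i %/ b = j %/ b -> i = j.
  by move=> _ _ /addIn.
have ci i j : i < N -> j < N -> child i = child j ->
    T (i %/ b) * b + i %% b = T (j %/ b) * b + j %% b -> i = j.
  by move=> _ _ /addIn.
have ct i j : i < N -> j < N -> child i = j %/ b -> T (i %/ b) <> T (j %/ b).
  by move=> _ _ <-; rewrite Tc; case: (T _).
have cd y : y < n ->
  (y < 2) + #|[set i : 'I_N | i %/ b == y]| + #|[set i : 'I_N | child i == y]|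
    <= b.+1.
  move=> yn; have c1 : #|[set i : 'I_N | i %/ b == y]| <= b.
    apply: (@card_ord_pair _ (fun i => i %/ b == y)) =>
      // i j /eqP iy /eqP jy m.
    by rewrite (divn_eq i b) m iy -jy -divn_eq.
  suff c2 : (y < 2) + #|[set i : 'I_N | child i == y]| <= 1 by card_lia.
  case: (ltnP y 2) => y2.
    rewrite (_ : [set i : 'I__ | child i == y] = set0) ?cards0 //.
    by apply/setP => i; rewrite !inE /child; lia.
  apply: (@card_ord_pair _ (fun i => child i == y) 1) =>
    // i j /eqP iy /eqP jy _.
  by move: iy; rewrite -jy => /addIn.
have L : layering n b N child T by split.
exists (layered b N child v0), (root_edge v0), (layer_coloring b N child T v0);
  split.
- exact: (layered_simple L).
- by move=> y; apply: (layered_degree v0 L).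
- exact: (layered_proper v0 L).
- by split; [move=> f; apply: (layer_coloring_None L) | rewrite setU11].
- move=> psi pc.
  (* The next index [j] is below [(i + 3) * b]. Counting from [i + 4] absorbs the offsets: one level
     multiplies this quantity by at most [b.+1]. *)
  have chain m i c : i < N -> psi (branch_edge b child v0 i) = Some c ->
      upper_half c = ~~ T (i %/ b) -> (i + 4) * b.+1 ^ m <= n ->
      exists s, [/\ size s = m, uniq s & forall j, j \in s -> [/\ i < j, j < N &
        psi (branch_edge b child v0 j) <> layer_coloring b N child T v0
          (branch_edge b child v0 j)]].
    elim: m i c => [|m IH] i c iN Ei hi im; first by exists [::].
    have h1 : (i + 4) * b.+1 <= n.
      by apply: leq_trans im;
        rewrite leq_mul2l expnS leq_pmulr ?expn_gt0 // orbT.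
    have yN : (child i).+1 * b <= N by rewrite /child /N; nia.
    have eG : branch_edge b child v0 i \in layered b N child v0.
      by apply/setU1P; right; apply/imsetP; exists (Ordinal iN).
    have ye : vx v0 (child i) \in branch_edge b child v0 i
      by rewrite !inE eqxx orbT.
    have nr j : j < N -> j %/ b = child i ->
      branch_edge b child v0 j <> branch_edge b child v0 i.
      move=> jN jc /(branch_edge_inj L jN iN) E.
      by have := leq_div j b; rewrite jc /child E; clear; lia.
    rewrite -Tc in hi.
    have [j [c' [jN jc Ej hj]]] := pushed_down L pc yN eG ye nr Ei hi.
    rewrite -jc in hj.
    have ij : i < j by have := leq_div j b; rewrite jc /child; clear; lia.
    have jlt : j + 4 <= (i + 4) * b.+1.
      have := divn_eq j b; rewrite jc /child; have := ltn_pmod j b0; clear; nia.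
    have jm : (j + 4) * b.+1 ^ m <= n.
      by apply: leq_trans im; rewrite expnS mulnA leq_mul2r jlt orbT.
    have [s [sm us hs]] := IH j c' jN Ej hj jm.
    exists (j :: s); split=> /=; first by rewrite sm.
      by rewrite us andbT; apply/negP => /hs[]; rewrite ltnn.
    move=> l; rewrite inE => /orP[/eqP ->|/hs[jl lN nl]].
      by split=> //; apply: (changed_type L jN Ej hj).
    by split=> //; apply: ltn_trans jl.
  have N2 : 2 * b <= N by rewrite /N; lia.
  have [i [c [iN i2 Ei hi]]] := root_pushes L pc N2.
  (* Here [i < 2 * b], so that [i + 4 <= 3 * b.+1]: this is the origin of the factor 3. *)
  have im : (i + 4) * b.+1 ^ k.-1 <= n.
    apply: leq_trans kn; rewrite -[in leqRHS](prednK k0) expnS mulnA leq_mul2r.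
    by apply/orP; right; have := divn_eq i b; have := ltn_pmod i b0; nia.
  have [s [sm us hs]] := chain _ _ _ iN Ei hi im.
  rewrite -(prednK k0) -sm.
  apply: (@changed_recourse _ _ _ _ _ _ L psi (i :: s)).
    by rewrite /= us andbT; apply/negP => /hs[]; rewrite ltnn.
  move=> j; rewrite inE => /orP[/eqP ->|/hs[]//].
  by split=> //; apply: (changed_type L iN Ei hi).
Qed.

(** If [n < 3 * D], one recoloring is enough since [n <= D ^ 3]. Otherwise [k] is the largest
    exponent with [3 * D ^ k <= n], and the factor 3 costs at most one more power of [D]. *)
Lemma forces_recourse n D : 4 <= D -> D < n ->
  exists k, [/\ 0 < k, n <= D ^ (k + 2) & forces n (2 * D - 2) D k].
Proof.
move=> D4 Dn; have -> : 2 * D - 2 = 2 * (D - 1) by lia.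
have D1 : (D - 1).+1 = D by lia.
case: (ltnP n (3 * D)) => n3.
  exists 1; split=> //; last by have := @forces_one n (D - 1); rewrite D1;
    apply; lia.
  by rewrite !expnS expn0; nia.
pose k := trunc_log D (n %/ 3).
have n30 : 0 < n %/ 3 by rewrite divn_gt0 //; lia.
have D2 : 1 < D by lia.
have := trunc_log_bounds D2 n30; rewrite -/k => /andP[lo hi].
have k0 : 0 < k.
  rewrite lt0n; apply/eqP => k0; move: hi.
  by rewrite k0 expn1 ltnNge leq_divRL // mulnC n3.
exists k; split=> //.
  have : n < 3 * D ^ k.+1 by move: hi; rewrite ltn_divLR // mulnC.
  move=> /ltnW h; apply: leq_trans h _; rewrite addn2 [leqRHS]expnS leq_mul2r;
    lia.
have := @forces_log n (D - 1) k; rewrite D1; apply=> //; first by lia.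
by move: lo; rewrite leq_divRL // mulnC.
Qed.

(** * From powers to logarithms *)

Import Order.TTheory GRing.Theory Num.Theory.

Lemma ln_nat_gt0 (R : realType) D : 1 < D -> (0 < ln (D%:R : R))%R.
Proof. by move=> D1; rewrite ln_gt0 // ltr1n. Qed.

Lemma ln_ratio_le (R : realType) D n m : 1 < D -> 0 < n -> n <= D ^ m ->
  (ln (n%:R : R) / ln D%:R <= m%:R)%R.
Proof.
move=> D1 n0 nD; rewrite ler_pdivrMr ?ln_nat_gt0 // mulr_natl -lnXn ?ltr0n
  ?(ltnW D1) //.
by rewrite ler_ln ?posrE ?exprn_gt0 ?ltr0n ?(ltnW D1) // -natrX ler_nat.
Qed.

Lemma ln_ratio_ge (R : realType) D n l m : 1 < D -> 0 < n -> D ^ l <= n ^ m ->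
  (l%:R <= m%:R * (ln (n%:R : R) / ln D%:R))%R.
Proof.
move=> D1 n0 nD; rewrite mulrA ler_pdivlMr ?ln_nat_gt0 // !mulr_natl.
rewrite -!lnXn ?ltr0n ?(ltnW D1) //.
by rewrite ler_ln ?posrE ?exprn_gt0 ?ltr0n ?(ltnW D1) // -!natrX ler_nat.
Qed.

(** Since [D <= (D - 1) ^ 2], all but one of the factors [D] are bounded together by [n ^ 2], and
    the last one by [n]. The exponent 3 becomes the recourse constant. *)
Lemma short_pow D n l : 4 <= D -> 0 < n ->
  (0 < l -> D <= n /\ (D - 1) ^ l.-1 <= n) ->
  D ^ l <= n ^ 3.
Proof.
move=> D4 n0; case: l => [_|l /(_ isT) /= [Dn ln]];
  first by rewrite expn0 expn_gt0 n0.
rewrite expnSr (expnSr n 2) leq_mul //.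
have D2 : D <= (D - 1) ^ 2 by rewrite -mulnn; nia.
apply: leq_trans (_ : ((D - 1) ^ 2) ^ l <= _).
  by case: l {ln} => [|l]; rewrite ?expn0 // leq_exp2r.
by rewrite -expnM mulnC expnM leq_exp2r.
Qed.

Theorem mainTheorem9 (R : realType) :
  (exists (ins del : cmd) (K T : nat) (C : R),
     forall D n : nat, 4 <= D ->
     forall (G : graph n) (phi : pcoloring n (2 * D - 2)) (s : memory),
     reachable ((n + D) ^ K) ins del D G phi s ->
     forall up : update n, valid_update D G up ->
     let G' := apply_update G up in
     exists (t : nat) (s' : memory) (phi' : pcoloring n (2 * D - 2)),
       [/\ exec ((n + D) ^ K) (program_for ins del up) (load D up s) t s',
           stores s' G' phi',
           proper_coloring G' phi',
           t <= T * #|edge up |: G|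
         & match up with
           | Insert _ _ =>
               shift_extension G' (edge up) phi phi' /\
               ((recourse G' phi phi')%:R <= C * (ln n%:R / ln D%:R))%R
           | Delete _ _ => recourse G' phi phi' = 0
           end])
  /\
  (exists c : R, (0 < c)%R /\
     forall D n : nat, 4 <= D -> D < n ->
     exists (G : graph n) (e : {set 'I_n}) (phi : pcoloring n (2 * D - 2)),
       [/\ simple G,
           maxdeg_le D G,
           proper_partial G phi,
           (forall f, f \in G -> (phi f = None <-> f = e)) /\ e \in G
         & forall psi : pcoloring n (2 * D - 2), proper_coloring G psi ->
             (c * (ln n%:R / ln D%:R) <= (recourse G phi psi)%:R)%R]).
Proof.
split.
  exists insertion, deletion, 5, (100 * 100), (3%:R)%R =>
    D n D_ge G phi s re up val G'.
  have g := reachable_good D_ge re.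
  have [t [s' [phi' [ex g' le H]]]] := update_step D_ge g val.
  have [st pr] := good_stores g'.
  exists t, s', phi'; split=> //.
  move: val H; rewrite /G';
    case: up {G' ex g' le st pr} => u v //= val [p [c [sh E sp]]].
  split; first by exists p, c.
  have n0 : 0 < n by apply: leq_ltn_trans (ltn_ord u).
  have phie : phi [set u; v] = None.
    by case: val => _ eG _; apply/eqP; rewrite (good_supp g).
  apply: le_trans (ln_ratio_ge R (l := size p) (m := 3) _ n0 _).
  - by rewrite ler_nat; apply: recourse_shift phie E.
  - exact: leq_trans D_ge.
  - exact: short_pow D_ge n0 sp.
(* [n <= D ^ (k + 2)] bounds the ratio of logarithms by [k + 2], which is at most [3 * k] because
   [k > 0]. *)
exists (3%:R^-1)%R; split=> [|D n D_ge Dn]; first by rewrite invr_gt0 ltr0n.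
have [k [k0 nk [G [e [phi [h1 h2 h3 h4 h5]]]]]] := forces_recourse D_ge Dn.
exists G, e, phi; split=> // psi pc.
have n0 : 0 < n := leq_ltn_trans (leq0n D) Dn.
have D1 : 1 < D by apply: leq_trans D_ge.
rewrite ler_pdivrMl ?ltr0n //; apply: le_trans (ln_ratio_le R D1 n0 nk) _.
rewrite -natrM ler_nat; have := h5 psi pc; lia.
Qed.
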